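(* Let $1\le k\le n$. Consider the single-hop building block model with i.i.d. link delays distributed as $X$ and exogenous updates whose i.i.d. interarrival times are distributed as $R$ with $E[R]=\frac1\mu$, under the earliest $k$ stopping scheme. Then the average age at an individual end node is $$\Delta_{(k,\mu)} = \frac{1}{k} \sum_{i=1}^{k} E[X_{i:n}] + \frac{2n-k}{2k}\left(E[X_{k:n}] + E[Z]\right) + \frac{\mathrm{Var}[X_{k:n}+Z]}{2\left(E[X_{k:n}] + E[Z]\right)}.$$
   Context: $X_{i:n}$ denotes the $i$-th smallest of $n$ i.i.d. copies $X_1,\dots,X_n$ of $X$. Link delays $X$ and interarrival times $R$ are almost surely positive random variables with finite second moments; ties between link delays are broken uniformly at random. Single-hop building block model: a source node has $n$ end nodes. Updates arrive at the source according to a renewal process with i.i.d. interarrival times distributed as $R$; each update is time-stamped with its arrival time. All link delays (over all links and all updates) are i.i.d. copies of $X$, independent of the arrivals. An update that arrives when the source is idle immediately starts service: it is sent to all $n$ end nodes simultaneously, and it would reach end node $i$ after its link delay. When the earliest $k$ of the $n$ end nodes have received it (after time $X_{k:n}$), the transmissions to the other $n-k$ nodes are terminated (those nodes never receive this update), and the source becomes idle. Updates arriving while the source is busy are dropped and lost. The source stays idle until the next arrival, which starts a new service. $Z$ is the waiting (idle) time from the completion of a service until the next arrival. So if a service starts at an arrival epoch and lasts $X_{k:n}$, then $X_{k:n}+Z$ is the time from that epoch to the first subsequent arrival epoch after the completion. In general $Z$ and $X_{k:n}$ may be dependent. The age at an end node at time $t$ is $\Delta(t)=t-u(t)$, where $u(t)$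 is the time-stamp of the most recent update received by that node. The average age is $\Delta=\lim_{\tau\to\infty}\frac1\tau\int_0^\tau\Delta(t)\,dt$ (almost surely); it is the same for every end node. *)

(* Defs.v *)
From HB Require Import structures.
From mathcomp Require Import all_boot all_order all_algebra all_fingroup.
From mathcomp Require Import all_classical all_reals all_analysis.

Set Implicit Arguments.
Unset Strict Implicit.
Unset Printing Implicit Defensive.

Import Order.TTheory GRing.Theory Num.Theory.
Import numFieldNormedType.Exports.

Local Open Scope classical_set_scope.
Local Open Scope ring_scope.

(* Restricted to measurable sets: the value of a measure on a non-measurable
   set is unconstrained. *)
Definition same_law (d : measure_display) (T : measurableType d) (R : realType)
    (P : probability T R) (X Y : {RV P >-> R}) : Prop :=
  forall A : set R, measurable A -> distribution P X A = distribution P Y A.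

Definition mutually_independent (d : measure_display) (T : measurableType d)
    (R : realType) (P : probability T R) (J : eqType)
    (F : J -> set (set T)) : Prop :=
  forall (s : seq J) (A : J -> set T), uniq s ->
    (forall j, j \in s -> F j (A j)) ->
    P (\bigcap_(j in [set` s]) A j) = (\prod_(j <- s) P (A j))%E.

(* Events determined by, respectively, one interarrival time, one link delay
   (update, node), and the tie-breaking permutation of one update. *)
Definition source_events (d : measure_display) (T : measurableType d)
    (R : realType) (n : nat) (r : nat -> T -> R) (x : nat -> 'I_n -> T -> R)
    (s : nat -> T -> {perm 'I_n}) (j : nat + nat * 'I_n + nat) :
    set (set T) :=
  match j with
  | inl (inl m) => preimage_set_system setT (r m) measurable
  | inl (inr (m, i)) => preimage_set_system setT (x m i) measurable
  | inr m => preimage_set_system setT (s m) setT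
  end.

Definition uniform_perm (d : measure_display) (T : measurableType d)
    (R : realType) (P : probability T R) (n : nat) (s : T -> {perm 'I_n}) :
    Prop :=
  forall p : {perm 'I_n}, measurable (s @^-1` [set p]) /\
    P (s @^-1` [set p]) = ((n`!)%:R^-1)%:E.

(* The i-th smallest value of x, for 1 <= i <= n. *)
Definition order_stat (R : realType) (n : nat) (x : 'I_n -> R) (i : nat) : R :=
  nth 0 (sort <=%R (codom x)) i.-1.

(* Ties between delays are resolved by the permutation s; as s is uniform,
   tied nodes appear in uniformly random order. *)
Definition reached_before (R : realType) (n : nat) (x : 'I_n -> R)
    (s : {perm 'I_n}) (i j : 'I_n) : bool :=
  (x i < x j) || ((x i == x j) && (s i < s j)%N).

Definition among_earliest (R : realType) (n k : nat) (x : 'I_n -> R)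
    (s : {perm 'I_n}) (i : 'I_n) : bool :=
  (#|[pred j | reached_before x s j i]| < k)%N.

(* In the pathwise definitions below, updates are numbered from 0, r m is the
   interarrival time preceding update m, x m i is the delay of the link to node
   i for update m (used only if the source serves update m), and s m breaks
   ties between the delays of update m. *)

Definition arrival (R : realType) (r : nat -> R) (m : nat) : R :=
  \sum_(0 <= j < m.+1) r j.

Definition completion (R : realType) (n k : nat) (r : nat -> R)
    (x : nat -> 'I_n -> R) (m : nat) : R :=
  arrival r m + order_stat (x m) k.

(* Completion time of the last service started by an update numbered below m.
   The source is idle at time 0; arrivals being almost surely positive, the
   value 0 for m = 0 lets the first update be served. *)
Fixpoint busy_until (R : realType) (n k : nat) (r : nat -> R)
    (x : nat -> 'I_n -> R) (m : nat) : R :=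
  if m is m'.+1 then
    if busy_until k r x m' < arrival r m' then completion k r x m'
    else busy_until k r x m'
  else 0.

(* An update arriving exactly at a completion time is dropped, in accordance
   with the strict inequality in next_arrival. *)
Definition served (R : realType) (n k : nat) (r : nat -> R)
    (x : nat -> 'I_n -> R) (m : nat) : Prop :=
  busy_until k r x m < arrival r m.

(* First arrival epoch after the completion of a service started by update m. *)
Definition next_arrival (R : realType) (n k : nat) (r : nat -> R)
    (x : nat -> 'I_n -> R) (m : nat) : R :=
  inf [set t | exists l : nat,
    [/\ (m < l)%N, completion k r x m < arrival r l & t = arrival r l]].

Definition idle_time (R : realType) (n k : nat) (r : nat -> R)
    (x : nat -> 'I_n -> R) (m : nat) : R :=
  next_arrival k r x m - completion k r x m.

Definition received_by (R : realType) (n k : nat) (r : nat -> R)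
    (x : nat -> 'I_n -> R) (s : nat -> {perm 'I_n}) (i : 'I_n) (t : R)
    (m : nat) : Prop :=
  [/\ served k r x m, among_earliest k (x m) (s m) i
    & arrival r m + x m i <= t].

(* u0 is the time-stamp held by the node at time 0. *)
Definition last_timestamp (R : realType) (n k : nat) (r : nat -> R)
    (x : nat -> 'I_n -> R) (s : nat -> {perm 'I_n}) (u0 : R) (i : 'I_n)
    (t : R) : R :=
  sup [set u | u = u0 \/
    exists m : nat, received_by k r x s i t m /\ u = arrival r m].

Definition age (R : realType) (n k : nat) (r : nat -> R)
    (x : nat -> 'I_n -> R) (s : nat -> {perm 'I_n}) (u0 : R) (i : 'I_n)
    (t : R) : R :=
  t - last_timestamp k r x s u0 i t.

Definition time_average (R : realType) (f : R -> R) (tau : R) : \bar R :=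
  ((tau^-1)%:E * \int[lebesgue_measure]_(t in `[0%R, tau]) (f t)%:E)%E.

Definition average_age_is (d : measure_display) (T : measurableType d)
    (R : realType) (P : probability T R) (Age : T -> R -> R)
    (Delta : \bar R) : Prop :=
  {ae P, forall w, time_average (Age w) tau @[tau --> +oo%R] --> Delta}.

(* Main.v *)
Require Import Defs.
From HB Require Import structures.
From mathcomp Require Import all_boot all_order all_algebra all_fingroup.
From mathcomp Require Import all_classical all_reals all_analysis.
From mathcomp Require Import measurable_realfun ring lra zify.

Set Implicit Arguments.
Unset Strict Implicit.
Unset Printing Implicit Defensive.

Import Order.TTheory GRing.Theory Num.Theory.
Import numFieldNormedType.Exports.

Local Open Scope classical_set_scope.
Local Open Scope ring_scope.

(* Record the delays, gaps and tie-breaks of the updates as a sequence of i.i.d.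
   blocks, and let theta be the shift to the first block of the next service.
   The length of a cycle depends only on the blocks it consumes, so theta
   preserves the law of the sequence (strong Markov property) and is ergodic;
   Birkhoff's theorem then gives almost sure averages along cycles.

   Let Y = X_(k:n) + Z be the length of a cycle, B the event that the node is
   among the k earliest, D its delay, and H the time from the start of a service
   until the node next receives an update, so that
     H = B D + (1 - B) (Y + H o theta).
   If time-stamps were renewed at each service start, the age would integrate to
   Y^2 / 2 over a cycle; the true age exceeds this by the earlier cycle lengths
   not yet covered by a reception, and a cycle stays uncovered for the time
   H o theta after its end.  So, up to boundary terms, the age integrates over m
   cycles to the sum of Y^2 / 2 + Y * (H o theta).  Exchangeability of the nodes gives E[B] = k / n,
   E[B Y] = (k / n) E[Y] and E[B D] = (1 / n) sum_(i <= k) E[X_(i:n)], whence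
   E[H], and the average age is E[Y^2 / 2 + Y * (H o theta)] / E[Y]. *)

(** * The ergodic theorem *)

(** The wait H looks ahead over an unbounded number of cycles, so the summands
    [Y^2 / 2 + Y * (H o theta)] of different cycles are dependent and the strong law for i.i.d.
    cycles does not apply to them; hence the ergodic theorem. The excess of the age, in contrast, is
    made of past cycles. A summation by parts charges each cycle length to the wait after its end,
    so that only the future enters, as a one-sided shift requires; and Y is settled by the blocks
    before the shift, so that [E[Y * (H o theta)] = E[Y] * E[H]]. With p = k / n, the recursion for
    H gives [E[H] = (E[B D] + (1 - p) E[Y]) / p]. Here [E[B D] / p] is the mean of the first k
    expected order statistics, and (1 - p) / p = (n - k) / k, added to the 1/2 that comes from
    [E[Y^2] = Var[Y] + E[Y]^2], is the coefficient (2n - k) / (2k). The delicate integrability is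
    that of [Y^2]: the last gap of a cycle straddles the completion and need not have the law of an
    interarrival time. Its square is bounded by the sum of the squares of all gaps that start no
    later than the completion. *)

Lemma exists_natr_gt (R : realType) (x : R) : exists b : nat, x < b%:R.
Proof.
exists (Num.truncn `|x|).+1; exact: (le_lt_trans (ler_norm x) (truncnS_gt _)).
Qed.

Lemma measurable_set_bool d (W : measurableType d) (b : W -> bool) :
  measurable_fun setT b -> measurable [set w | b w].
Proof.
by move=> mb; have := mb measurableT [set true] Logic.I; rewrite setTI.
Qed.

Lemma measurable_set_ltr d (W : measurableType d) (R : realType) (f g : W -> R) :
  measurable_fun setT f -> measurable_fun setT g ->
  measurable [set w | f w < g w].
Proof. by move=> mf mg; apply: measurable_set_bool; exact: measurable_fun_ltr. Qed.

Section ergodic.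
Context d (W : measurableType d) (R : realType) (Q : probability W R).
Variable theta : W -> W.
Hypothesis mtheta : measurable_fun [set: W] theta.
Hypothesis theta_preserving :
  forall A, measurable A -> Q (theta @^-1` A) = Q A.

Lemma integral_preserving (f : W -> \bar R) : measurable_fun setT f ->
  (forall w, 0 <= f w)%E ->
  (\int[Q]_w f (theta w) = \int[Q]_w f w)%E.
Proof.
move=> mf f0.
rewrite -[LHS](@ge0_integral_pushforward _ _ _ _ _ theta mtheta Q setT f)//.
apply: eq_measure_integral => A mA _; exact: theta_preserving.
Qed.

Lemma integrable_preserving (f : W -> R) : Q.-integrable setT (EFin \o f) ->
  Q.-integrable setT (EFin \o (f \o theta)).
Proof.
move=> /integrableP[mf foo]; apply/integrableP; split.
  exact: (measurableT_comp mf mtheta).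
rewrite (integral_preserving (f := fun w => `|(f w)%:E|%E))//.
by apply: measurableT_comp mf.
Qed.

Lemma ae_preserving (A : W -> Prop) :
  {ae Q, forall w, A w} -> {ae Q, forall w, A (theta w)}.
Proof.
move=> [N [mN N0 AN]]; exists (theta @^-1` N); split.
- by rewrite -[X in measurable X]setTI; exact: mtheta.
- by rewrite theta_preserving.
- by move=> w /= Aw; apply: AN.
Qed.

Lemma ae_iter_preserving (A : W -> Prop) :
  {ae Q, forall w, A w} -> {ae Q, forall w n, A (iter n theta w)}.
Proof.
move=> Aw; apply: ae_foralln => n; elim: n => [|n IH]//.
have /= := ae_preserving IH.
by apply: filterS => w; rewrite -iterSr.
Qed.

(* The maximum of the first n+1 partial Birkhoff sums of f, the empty one
   included. *)
Fixpoint max_birkhoff (f : W -> R) (n : nat) : W -> R :=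
  if n is n'.+1 then fun w => Num.max 0 (f w + max_birkhoff f n' (theta w))
  else fun=> 0.

Lemma max_birkhoff_ge0 f n w : 0 <= max_birkhoff f n w.
Proof. by case: n => //= n; rewrite le_max lexx. Qed.

Lemma max_birkhoffS f n w : max_birkhoff f n w <= max_birkhoff f n.+1 w.
Proof.
elim: n w => [|n IH] w; first by rewrite max_birkhoff_ge0.
rewrite /= ge_max le_max lexx /= le_max; apply/orP; right.
by rewrite lerD2l; exact: (IH (theta w)).
Qed.

Lemma max_birkhoff_le f w : {homo (fun n => max_birkhoff f n w) : m n / (m <= n)%N >-> m <= n}.
Proof. by apply/nondecreasing_seqP => n; exact: max_birkhoffS. Qed.

Lemma sum_le_max_birkhoff f n w :
  \sum_(0 <= i < n) f (iter i theta w) <= max_birkhoff f n w.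
Proof.
elim: n w => [|n IH] w; first by rewrite big_geq.
rewrite big_nat_recl//= le_max; apply/orP; right; rewrite lerD2l.
apply: le_trans (IH _).
by rewrite le_eqVlt; apply/orP; left; apply/eqP/eq_bigr => i _; rewrite -iterS -iterSr.
Qed.

Lemma integrable_max_birkhoff f n : Q.-integrable setT (EFin \o f) ->
  Q.-integrable setT (EFin \o max_birkhoff f n).
Proof.
move=> fi; elim: n => [|n IH]; first exact: finite_measure_integrable_cst.
have -> : EFin \o max_birkhoff f n.+1 =
    (((EFin \o f) \+ (EFin \o (max_birkhoff f n \o theta)))^\+)%E.
  by apply/funext => w /=; rewrite funeposE /= maxC EFin_max.
by apply: integrable_funepos => //; apply: integrableD => //;
  exact: integrable_preserving.
Qed.

Hypothesis theta_ergodic : forall I, measurable I -> theta @^-1` I = I ->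
  Q I = 0%E \/ Q I = 1%E.

(* Garsia's argument: unboundedness is an invariant event, and if it had
   probability 1, then integrating
   max_birkhoff n.+1 - max_birkhoff n o theta >= 0 and letting n go to infinity
   would give a nonnegative integral of f. *)
Lemma max_birkhoff_bounded (f : W -> R) : Q.-integrable setT (EFin \o f) ->
  \int[Q]_w f w < 0 ->
  {ae Q, forall w, exists C : nat, forall n, max_birkhoff f n w <= C%:R}.
Proof.
move=> fi f_lt0.
have Mi n := integrable_max_birkhoff n fi.
have mM n : measurable_fun setT (max_birkhoff f n).
  by apply/measurable_EFinP; have /integrableP[] := Mi n.
have mf : measurable_fun setT f.
  by apply/measurable_EFinP; have /integrableP[] := fi.
pose I := \bigcap_C \bigcup_n [set w | C%:R < max_birkhoff f n w].
have mI : measurable I.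
  apply: bigcapT_measurable => C; apply: bigcupT_measurable => n.
  exact: measurable_set_ltr.
have thetaI : theta @^-1` I = I.
  (* Up to a maximum with 0, [max_birkhoff f n.+1] at w and [max_birkhoff f n] at [theta w] differ
     by the finite number [f w], so one sequence is unbounded exactly when the other is. *)
  apply/seteqP; split => w.
    move=> wI C _; have [b bb] : exists b : nat, C%:R - f w < b%:R.
      by exact: exists_natr_gt.
    have [n _ /= nb] := wI b Logic.I; exists n.+1 => //=.
    by rewrite lt_max -ltrBlDl (lt_trans bb nb) orbT.
  move=> wI C _; have [b bb] : exists b : nat, C%:R + f w < b%:R.
    by exact: exists_natr_gt.
  have [n _ /= nb] := wI b Logic.I; exists n => //=.
  have := lt_le_trans nb (max_birkhoffS f n w) => /=.
  rewrite lt_max ltNge ler0n/= => bm.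
  by have := lt_trans bb bm; rewrite addrC ltrD2l.
have [I0|I1] := theta_ergodic mI thetaI.
  exists I; split => // w /= /forallNP nb C _ /=.
  apply: contrapT => h; apply: (nb C) => n.
  by rewrite leNgt; apply/negP => ?; apply: h; exists n.
exfalso.
have Iae : {ae Q, forall w, I w}.
  exists (~` I); split; [exact: measurableC| |by []].
  by rewrite probability_setC// I1 subee.
(* The difference to be integrated, in a form which shows that it is dominated by [|f|] and that on
   I it is eventually equal to f. *)
pose g n w : R := Num.max (- max_birkhoff f n (theta w)) (f w).
have gE n w : g n w = max_birkhoff f n.+1 w - max_birkhoff f n (theta w).
  by rewrite /g /= addr_maxl sub0r addrK.
have mg n : measurable_fun setT (g n).
  apply: measurable_maxr => //; apply: measurableT_comp => //.
  exact: measurableT_comp.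
have Mcomp n : Q.-integrable setT (EFin \o (max_birkhoff f n \o theta)).
  exact: integrable_preserving.
suff : (0 <= \int[Q]_w (f w)%:E)%E.
  by move=> /fine_ge0; rewrite leNgt; move: f_lt0; rewrite /Rintegral => ->.
have cv : (\int[Q]_w (g n w)%:E)%E @[n --> \oo] --> (\int[Q]_w (f w)%:E)%E.
  have [|||||_ _ //] := @dominated_convergence _ W R Q setT measurableT
    (fun n => EFin \o g n) (EFin \o f) (fun w => `|(f w)%:E|%E).
  - by move=> n; exact/measurable_EFinP.
  - exact/measurable_EFinP.
  - apply: filterS Iae => w Iw _; apply: cvg_near_cst.
    have [b bb] : exists b : nat, - f w < b%:R.
      by exact: exists_natr_gt.
    have : I (theta w) by rewrite -[I]thetaI in Iw.
    move=> /(_ b Logic.I)[m _ /= bm]; exists m => // n /= mn.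
    congr EFin; rewrite /g; apply/max_idPr; rewrite lerNl.
    by apply: (le_trans (ltW bb)); apply: (le_trans (ltW bm)); exact: max_birkhoff_le.
  - exact: integrable_abse fi.
  - apply: aeW => w n _ /=; rewrite lee_fin /g ler_norml; apply/andP; split.
      by rewrite le_max; apply/orP; right; rewrite lerNl -normrN ler_norm.
    by rewrite ge_max ler_norm andbT (@le_trans _ _ 0)// oppr_le0 max_birkhoff_ge0.
have lcv : limn (fun n => \int[Q]_w (g n w)%:E)%E = (\int[Q]_w (f w)%:E)%E.
  exact/cvg_lim.
rewrite -lcv; apply: lime_ge; first by apply/cvg_ex; eexists; exact: cv.
apply: nearW => n.
under eq_integral do rewrite gE EFinB.
rewrite integralB_EFin//.
rewrite sube_ge0; last first.
  by apply/orP; left; apply: integrable_fin_num => //; exact: (Mcomp n).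
rewrite (integral_preserving (f := EFin \o max_birkhoff f n))//.
- apply: ge0_le_integral => //.
  + by move=> w _; rewrite lee_fin max_birkhoff_ge0.
  + exact/measurable_EFinP.
  + exact/measurable_EFinP/(mM n.+1).
  + by move=> w _; rewrite lee_fin; exact: max_birkhoffS.
- exact/measurable_EFinP.
- by move=> w; rewrite lee_fin max_birkhoff_ge0.
- exact: Mcomp.
Qed.

(** With a just above the mean, [f - a] has a negative integral, so its partial sums are bounded on
    almost every path. The margins are countably many, so that one null set serves them all. *)
Lemma birkhoff_upper (f : W -> R) : Q.-integrable setT (EFin \o f) ->
  {ae Q, forall w (l : nat), exists C : nat, forall n : nat,
    \sum_(0 <= i < n) f (iter i theta w) <=
      C%:R + n%:R * (\int[Q]_w f w + l.+1%:R^-1)}.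
Proof.
move=> fi; apply: ae_foralln => l.
pose a := \int[Q]_w f w + l.+1%:R^-1.
pose g w := f w - a.
have ai : Q.-integrable setT (EFin \o cst a) by exact: finite_measure_integrable_cst.
have gi : Q.-integrable setT (EFin \o g).
  by rewrite (_ : _ \o _ = (EFin \o f) \- (EFin \o cst a))%E//; exact: integrableB.
have : \int[Q]_w g w < 0.
  rewrite RintegralB//= Rintegral_cst//= probability_setT/= mulr1.
  by rewrite /a opprD addrA subrr sub0r oppr_lt0 invr_gt0.
move=> /(max_birkhoff_bounded gi); apply: filterS => w [C wC].
exists C => n; rewrite -lerBlDr; apply: le_trans (wC n).
apply: le_trans (sum_le_max_birkhoff _ _ _).
by rewrite sumrB big_const_nat subn0 iter_addr addr0 mulr_natl.
Qed.

(** The upper bound is applied to f and to -f; the constants, which depend on the path, vanish after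
    division by n. *)
Theorem birkhoff (f : W -> R) : Q.-integrable setT (EFin \o f) ->
  {ae Q, forall w, (n%:R^-1 * \sum_(0 <= i < n) f (iter i theta w))
    @[n --> \oo] --> \int[Q]_w f w}.
Proof.
move=> fi; have nfi : Q.-integrable setT (EFin \o (fun w => - f w)).
  by rewrite (_ : _ \o _ = \- (EFin \o f))%E//; exact: integrableN.
apply: filterS2 (birkhoff_upper fi) (birkhoff_upper nfi) => w U L.
have NE : \int[Q]_w - f w = - \int[Q]_w f w.
  rewrite -mulN1r -RintegralZl//.
  by apply: eq_Rintegral => x _; rewrite mulN1r.
rewrite {}NE in L.
set m := \int[Q]_w f w in U L *.
apply/cvgrPdist_le => e e0.
have [l le] : exists l : nat, l.+1%:R^-1 <= e / 2.
  have [[|l] le] := exists_natr_gt (e / 2)^-1.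
    by move: le; rewrite ltNge invr_ge0 divr_ge0// ltW.
  by exists l; rewrite -[leRHS]invrK lef_pV2 ?posrE ?invr_gt0 ?divr_gt0// ltW.
have [C1 H1] := U l; have [C2 H2] := L l.
have [b bgt] := exists_natr_gt ((C1 + C2)%:R / (e / 2)).
exists b.+1 => // n /= nb.
have n0 : 0 < n%:R :> R by rewrite ltr0n; exact: leq_trans nb.
have Cn : (C1 + C2)%:R <= n%:R * (e / 2).
  rewrite -ler_pdivrMr ?divr_gt0//; apply: ltW.
  by apply: (lt_le_trans bgt); rewrite ler_nat ltnW.
have := H1 n; have := H2 n; rewrite sumrN.
set S := \sum_(0 <= i < n) _ => h2 h1.
have le' : n%:R * l.+1%:R^-1 <= n%:R * (e / 2) by rewrite ler_pM2l.
rewrite natrD in Cn; have C10 : 0 <= C1%:R :> R by [].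
have C20 : 0 <= C2%:R :> R by [].
rewrite ler_norml; apply/andP; split.
  rewrite lerNl opprB lerBlDl mulrC ler_pdivrMr//.
  have -> : (m + e) * n%:R = n%:R * m + n%:R * (e / 2) + n%:R * (e / 2) by field.
  move: h1; rewrite mulrDr; move: le' Cn C10 C20.
  move: (n%:R * (e / 2)) (n%:R * m) (n%:R / l.+1%:R) => x y z; lra.
rewrite lerBlDl -lerBlDr mulrC ler_pdivlMr//.
have -> : (m - e) * n%:R = n%:R * m - n%:R * (e / 2) - n%:R * (e / 2) by field.
move: h2; rewrite mulrDr mulrN; move: le' Cn C10 C20.
by move: (n%:R * (e / 2)) (n%:R * m) (n%:R / l.+1%:R) => x y z; lra.
Qed.

End ergodic.

(** * Independent blocks *)

Section path_space.
Context (R : realType) (J : eqType).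

Definition cylinder (s : seq J) (A : J -> set R) : set (J -> R) :=
  [set w | forall j, j \in s -> A j (w j)].

Definition cylinders : set (set (J -> R)) :=
  [set C | exists s A, [/\ uniq s, forall j, measurable (A j) & C = cylinder s A]].

(** The product sigma-algebra. Every random input, the permutations included, is stored as a real
    coordinate, so that one product type carries the whole model. *)
Definition path : measurableType (sigma_display cylinders) :=
  [the measurableType _ of g_sigma_algebraType cylinders].

Lemma cylinders_setT : cylinders setT.
Proof.
by exists [::], (fun=> setT); split => //; apply/seteqP; split => w.
Qed.

Lemma cylinders_setI : setI_closed cylinders.
Proof.
move=> _ _ [s [A [us mA ->]]] [t [B [ut mB ->]]].
(* Cylinders are indexed by duplicate-free lists, hence [undup]; an index absent from one of the
   lists gets no constraint from it. *)
exists (undup (s ++ t)), (fun j => (if j \in s then A j else setT) `&`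
                                (if j \in t then B j else setT)).
split; first exact: undup_uniq.
  by move=> j; apply: measurableI; case: ifP.
apply/seteqP; split => w.
  by move=> [sw tw] j _; split; case: ifP => // h; [exact: sw|exact: tw].
move=> h; split => j js.
  by have := h j; rewrite mem_undup mem_cat js => /(_ isT)[].
by have := h j; rewrite mem_undup mem_cat js orbT => /(_ isT)[_].
Qed.

Lemma measurable_path d (X : measurableType d) (F : X -> path) :
  (forall j, measurable_fun setT (fun x => F x j)) -> measurable_fun setT F.
Proof.
move=> mF; apply: (@measurability _ _ X path setT F cylinders) => //.
move=> _ [_ [s [A [_ mA ->]]] <-]; rewrite setTI.
elim: s => [|j s IH].
  rewrite [X in measurable X](_ : _ = setT)//.
  by apply/seteqP; split => x.
rewrite [X in measurable X](_ : _ = (fun x => F x j) @^-1` (A j) `&`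
   (F @^-1` cylinder s A)).
  by apply: measurableI => //; rewrite -[X in measurable X]setTI; exact: mF.
apply/seteqP; split => x.
  move=> h; split; first by apply: h; rewrite inE eqxx.
  by move=> i si; apply: h; rewrite inE si orbT.
by move=> [h1 h2] i; rewrite inE => /predU1P[->|]//; exact: h2.
Qed.

Lemma measurable_coord j : measurable_fun setT (fun w : path => w j).
Proof.
move=> _ A mA; rewrite setTI; apply: sub_sigma_algebra.
exists [:: j], (fun=> A); split => //.
apply/seteqP; split => w.
  by move=> h i; rewrite inE => /eqP ->.
by apply; rewrite inE.
Qed.

Lemma path_measure_unique (m1 m2 : {measure set path -> \bar R}) :
  (forall s A, uniq s -> (forall j, measurable (A j)) ->
    m1 (cylinder s A) = m2 (cylinder s A)) ->
  (m1 setT < +oo)%E ->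
  forall C, measurable C -> m1 C = m2 C.
Proof.
move=> m12 m1oo C mC.
apply: (@measure_unique _ _ path cylinders (fun=> setT)) => //.
- exact: cylinders_setI.
- by move=> _; exact: cylinders_setT.
- by rewrite bigcup_const.
- by move=> _ [s [A [us mA ->]]]; exact: m12.
Qed.

End path_space.

Definition block_index (K : eqType) : eqType := [the eqType of (nat * K)%type].

(** * Strong Markov property and ergodicity for i.i.d. blocks *)

Section block_paths.
Context (R : realType) (K : eqType).
Local Notation W := (path R (block_index K)).

Definition shift (m : nat) (w : W) : W := fun j => w ((m + j.1)%N, j.2).

Definition glue (m : nat) (ab : W * W) : W :=
  fun j => if (j.1 < m)%N then ab.1 j else ab.2 ((j.1 - m)%N, j.2).

(** This replaces a filtration: a function or event is known from the first m blocks when it does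
    not distinguish agreeing paths. *)
Definition agree (m : nat) (w w' : W) := forall j, (j.1 < m)%N -> w j = w' j.

Lemma measurable_shift m : measurable_fun setT (shift m).
Proof. by apply: measurable_path => j; exact: measurable_coord. Qed.

Lemma measurable_glue m : measurable_fun setT (glue m).
Proof.
apply: measurable_path => j; rewrite /glue; case: (boolP (j.1 < m)%N) => jm.
  exact: (measurableT_comp (measurable_coord _) measurable_fst).
exact: (measurableT_comp (measurable_coord _) measurable_snd).
Qed.

Lemma measurable_glue2 m a : measurable_fun setT (fun b => glue m (a, b)).
Proof.
apply: (measurableT_comp (measurable_glue m)).
exact: measurable_fun_pair.
Qed.

Lemma shift_glue m ab : shift m (glue m ab) = ab.2.
Proof.
apply/funext => -[i k]; rewrite /shift /glue /= ltnNge leq_addr /=.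
by rewrite addKn.
Qed.

Lemma agree_glue m ab : agree m (glue m ab) ab.1.
Proof. by move=> j jm; rewrite /glue jm. Qed.

Lemma shift0 w : shift 0 w = w.
Proof. by apply/funext => -[i k]. Qed.

Lemma shift_add m n w : shift m (shift n w) = shift (n + m) w.
Proof. by apply/funext => -[i k]; rewrite /shift /= addnA. Qed.

Variable Q : probability W R.
(** [nu] ignores the block number, so the product formula below says at once that all coordinates
    are independent and that the blocks are identically distributed. *)
Variable nu : K -> set R -> \bar R.
Hypothesis Q_cylinder : forall s A, uniq s -> (forall j, measurable (A j)) ->
  Q (cylinder s A) = (\prod_(j <- s) nu j.2 (A j))%E.

Let Q1 : Q [set: W] = 1%E. Proof. exact: probability_setT. Qed.

Let QX (A B : set W) : measurable A -> measurable B ->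
  (Q \x Q)%E (A `*` B) = (Q A * Q B)%E.
Proof. by move=> mA mB; exact: product_measure1E. Qed.

Let integral1 : (\int[Q]__ 1 = 1)%E.
Proof. by rewrite integral_cst// mul1e; exact: Q1. Qed.

Let mrestrict (f : W -> \bar R) (D : set W) : measurable D ->
  measurable_fun setT f -> measurable_fun setT (f \_ D).
Proof. by move=> mD mf; apply/(measurable_restrictT f mD); exact: measurable_funTS. Qed.

Lemma preimage_glue_cylinder m s A : (forall j, measurable (A j)) ->
  exists B1 B2, [/\ measurable B1, measurable B2,
    glue m @^-1` cylinder s A = B1 `*` B2 &
    (B1 = cylinder [seq j <- s | (j.1 < m)%N] A) /\
    (B2 = cylinder [seq ((j.1 - m)%N, j.2) | j <- s & (m <= j.1)%N]
            (fun j => A ((m + j.1)%N, j.2)))].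
Proof.
move=> mA.
(* By induction on the list, because t may have repetitions, which members of [cylinders] may
   not. *)
have mC t B : (forall j, measurable (B j)) -> measurable (cylinder t B : set W).
  move=> mB; rewrite [X in measurable X](_ : _ =
     (fun w : W => w : W) @^-1` cylinder t B)//.
  elim: t => [|j t IH].
    by rewrite [X in measurable X](_ : _ = setT)//; apply/seteqP; split => w.
  rewrite [X in measurable X](_ : _ = (fun w : W => w j) @^-1` (B j) `&`
     (cylinder t B : set W)).
    apply: measurableI => //; rewrite -[X in measurable X]setTI.
    exact: measurable_coord.
  apply/seteqP; split => w.
    move=> h; split; first by apply: h; rewrite inE eqxx.
    by move=> i si; apply: h; rewrite inE si orbT.
  by move=> [h1 h2] i; rewrite inE => /predU1P[->|]//; exact: h2.
exists (cylinder [seq j <- s | (j.1 < m)%N] A).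
exists (cylinder [seq ((j.1 - m)%N, j.2) | j <- s & (m <= j.1)%N]
            (fun j => A ((m + j.1)%N, j.2))); split => //; [exact: mC|exact: mC|].
apply/seteqP; split => -[a b] /=.
  move=> h; split => j.
    rewrite mem_filter => /andP[jm js]; have := h j js.
    by rewrite /glue jm.
  move=> /mapP[i]; rewrite mem_filter => /andP[mi si] ->.
  by have := h i si; rewrite /glue ltnNge mi /= subnKC//; case: (i).
move=> [h1 h2] j js; rewrite /glue; case: ltnP => jm /=.
  by apply: h1; rewrite mem_filter jm.
have := h2 ((j.1 - m)%N, j.2); rewrite /= subnKC//.
case: j js jm {h1 h2} => i k js jm /=; apply.
by apply/mapP; exists (i, k) => //; rewrite mem_filter jm.
Qed.

(** On cylinders both sides are products of values of [nu]: the indices split into those below m and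
    those from m on, and renumbering the latter does not change [nu]. *)
Lemma glue_law m C : measurable C -> (Q \x Q)%E (glue m @^-1` C) = Q C.
Proof.
move=> mC; apply: esym.
have := @path_measure_unique R _ Q
  (measure_function_pushforward__canonical__measure_function_Measure
     (Q \x Q)%E (measurable_glue m)).
apply=> //; last by rewrite [X in (X < _)%E]Q1 ltry.
move=> s A us mA.
rewrite [RHS]/= /pushforward.
have [B1 [B2 [mB1 mB2 -> [B1E B2E]]]] := preimage_glue_cylinder m s mA.
rewrite QX// {}B1E {}B2E !Q_cylinder//; first last.
- by rewrite filter_uniq.
- rewrite map_inj_in_uniq ?filter_uniq// => -[i k] [i' k'].
  rewrite !mem_filter /= => /andP[mi _] /andP[mi' _] [e ->].
  by rewrite -(subnKC mi) e subnKC.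
transitivity (\prod_(j <- s) nu j.2 (A j))%E; first exact: Q_cylinder.
rewrite (bigID (fun j : block_index K => (j.1 < m)%N))/= big_filter; congr (_ * _)%E.
rewrite big_map big_filter; under eq_bigl do rewrite -leqNgt.
by apply: eq_bigr => -[i k]/= mi; rewrite subnKC.
Qed.

Lemma glue_integral m (h : W -> \bar R) : measurable_fun setT h ->
  (forall w, 0 <= h w)%E ->
  (\int[Q]_w h w = \int[Q]_a \int[Q]_b h (glue m (a, b)))%E.
Proof.
move=> mh h0.
transitivity (\int[pushforward (Q \x Q)%E (glue m)]_w h w)%E.
  apply: eq_measure_integral; first exact: measurable_glue.
  by move=> mg A mA _; exact: (esym (glue_law m mA)).
rewrite (ge0_integral_pushforward (measurable_glue m))// preimage_setT.
rewrite (fubini_tonelli1 (h \o glue m))//.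
  exact: (measurableT_comp mh (measurable_glue m)).
by move=> ab; exact: h0.
Qed.

(** On a glued path the first factor sees only a and the second only b, so the double integral
    separates. *)
Lemma shift_independent m (f g : W -> \bar R) :
  measurable_fun setT f -> (forall w, 0 <= f w)%E ->
  measurable_fun setT g -> (forall w, 0 <= g w)%E ->
  (forall w w', agree m w w' -> f w = f w') ->
  (\int[Q]_w (f w * g (shift m w)) = (\int[Q]_w f w) * (\int[Q]_w g w))%E.
Proof.
move=> mf f0 mg g0 fm; rewrite (@glue_integral m); first last.
- by move=> w; rewrite mule_ge0.
- by apply: emeasurable_funM => //; exact: (measurableT_comp mg (measurable_shift m)).
rewrite -ge0_integralZr ?integral_ge0//.
apply: eq_integral => a _; rewrite -ge0_integralZl//.
apply: eq_integral => b _; rewrite shift_glue/=; congr (_ * _)%E.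
by apply: fm; exact: agree_glue.
Qed.

(** A stopping time, given by the events that it equals m: disjoint, almost surely exhaustive, and
    each known from the first m blocks. [theta] shifts by its value. *)
Variable stop : nat -> set W.
Variable theta : W -> W.
Hypothesis mstop : forall m, measurable (stop m).
Hypothesis stop0 : stop 0%N = set0.
Hypothesis stop_trivIset : trivIset setT stop.
Hypothesis stop_ae : {ae Q, forall w, exists m, stop m w}.
Hypothesis stop_agree : forall m w w', agree m w w' -> stop m w -> stop m w'.
Hypothesis mtheta : measurable_fun setT theta.
Hypothesis theta_stop : forall m w, stop m w -> theta w = shift m w.

Lemma agreeC m w w' : agree m w w' -> agree m w' w.
Proof. by move=> ww j /ww. Qed.

Lemma integral_stop (f : W -> \bar R) : measurable_fun setT f ->
  (forall w, 0 <= f w)%E ->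
  (\int[Q]_w f w = \sum_(0 <= m <oo) \int[Q]_(w in stop m) f w)%E.
Proof.
move=> mf f0; rewrite -ge0_integral_bigcup//; last exact: measurable_funTS.
have mU : measurable (\bigcup_m stop m) by exact: bigcupT_measurable.
rewrite [RHS]integral_mkcond/=; apply: ge0_ae_eq_integral => //.
- exact: mrestrict.
- by move=> w _; rewrite patchE; case: ifP.
- apply: filterS stop_ae => w [m mw] _; rewrite patchE mem_set//.
  by exists m.
Qed.

(** On [stop m] the map [theta] is [shift m], and f restricted to [stop m] is known from the first m
    blocks, so [shift_independent] applies to each term of the decomposition by [stop]. *)
Lemma strong_markov (f g : W -> \bar R) (c : R) :
  measurable_fun setT f -> (forall w, 0 <= f w)%E ->
  measurable_fun setT g -> (forall w, 0 <= g w)%E ->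
  (forall m w w', agree m w w' -> stop m w -> f w = f w') ->
  (\int[Q]_w g w = c%:E)%E ->
  (\int[Q]_w (f w * g (theta w)) = (\int[Q]_w f w) * c%:E)%E.
Proof.
move=> mf f0 mg g0 fm gc.
have mgt : measurable_fun setT (g \o theta) by exact: measurableT_comp.
rewrite integral_stop; last 2 first.
  exact: emeasurable_funM.
  by move=> w; rewrite mule_ge0.
rewrite [in RHS]integral_stop// muleC -nneseriesZl; last first.
  by move=> m _; exact: integral_ge0.
apply: eq_eseriesr => m _.
rewrite integral_mkcond [in RHS]integral_mkcond muleC -gc.
rewrite -(@shift_independent m)//; first last.
- move=> w w' ww; rewrite !patchE; case: ifPn => [|/negP] h.
    rewrite mem_set; first by apply: fm ww _; rewrite -in_setE.
    by apply: stop_agree ww _; rewrite -in_setE.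
  rewrite ifF//; apply/negP => h'; apply: h; rewrite in_setE in h'.
  by rewrite in_setE; apply: stop_agree h'; exact: agreeC.
- by move=> w; rewrite patchE; case: ifP.
- exact: mrestrict.
apply: eq_integral => w _; rewrite !patchE; case: ifPn => h.
  by rewrite -(theta_stop (m := m))// -in_setE.
by rewrite mul0e.
Qed.

Lemma stop_preserving C : measurable C -> Q (theta @^-1` C) = Q C.
Proof.
move=> mC; have mtC : measurable (theta @^-1` C).
  by rewrite -[X in measurable X]setTI; exact: mtheta.
have QC : (\int[Q]_w (\1_C w)%:E = (fine (Q C))%:E)%E.
  by rewrite integral_indic// setIT fineK// fin_num_measure.
have := @strong_markov (fun=> 1%E) (EFin \o \1_C) _ _ _ _ _ _ QC.
rewrite integral1 mul1e fineK ?fin_num_measure// => <-//.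
- under eq_integral do rewrite mul1e.
  by rewrite [RHS](_ : _ = \int[Q]_w (\1_(theta @^-1` C) w)%:E)%E//
     integral_indic// setIT.
- exact/measurable_EFinP.
- by move=> w /=; rewrite lee_fin.
Qed.

(* By induction on n: given that stop m holds and given the first m blocks, A
   depends on at most n - m of the remaining blocks, while I is again I. *)
Lemma invariant_independent n (A I : set W) : measurable A ->
  (forall w w', agree n w w' -> A w -> A w') ->
  measurable I -> theta @^-1` I = I -> Q (A `&` I) = (Q A * Q I)%E.
Proof.
move=> mA An mI tI.
elim: n {-2}n (leqnn n) A mA An => [|N IH] n nN A mA An.
  (* All paths agree on zero blocks, so A is empty or the whole space. *)
  have [[w Aw]|/forallNP A0] := pselect (exists w, A w).
    have -> : A = setT.
      apply/seteqP; split => // w' _; apply: An Aw => j.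
      by move: nN; rewrite leqn0 => /eqP ->.
    by rewrite setTI Q1 mul1e.
  have -> : A = set0 by apply/seteqP; split => // w /A0.
  by rewrite set0I measure0 mul0e.
have e01 (B : set W) w : (0 <= (\1_B w)%:E :> \bar R)%E by rewrite lee_fin.
have me1 (B : set W) : measurable B ->
    measurable_fun setT (fun w => (\1_B w)%:E : \bar R).
  by move=> mB; exact/measurable_EFinP.
have QE B : measurable B -> Q B = (\int[Q]_w (\1_B w)%:E)%E.
  by move=> mB; rewrite integral_indic// setIT.
have [q q0 IE] : exists2 q, 0 <= q & Q I = q%:E.
  by exists (fine (Q I)); [exact: fine_ge0|rewrite fineK// fin_num_measure].
have stopI m B : measurable B ->
    (\int[Q]_(w in stop m) (\1_B w)%:E =
     \int[Q]_a \int[Q]_b (\1_(stop m) a * \1_B (glue m (a, b)))%:E)%E.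
  move=> mB; rewrite integral_mkcond (@glue_integral m (_ \_ _)); last 2 first.
  - by apply: mrestrict => //; exact: me1.
  - by move=> w; rewrite patchE; case: ifP.
  apply: eq_integral => a _; apply: eq_integral => b _; rewrite patchE.
  have -> : (glue m (a, b) \in stop m) = (a \in stop m).
    apply/idP/idP; rewrite !in_setE; apply: stop_agree; first exact: agree_glue.
    exact/agreeC/agree_glue.
  rewrite [\1_(stop m) a]indicE; case: ifP; first by rewrite mul1r.
  by rewrite mul0r.
rewrite (QE (A `&` I)); last exact: measurableI.
rewrite integral_stop//; last by apply: me1; exact: measurableI.
rewrite (QE A)// [in RHS]integral_stop; last 2 first.
- exact: me1.
- by [].
rewrite IE muleC -nneseriesZl; last by move=> m _; exact: integral_ge0.
(* As [stop 0] is empty, at least one block is consumed; this is what makes the induction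
   descend. *)
apply: eq_eseriesr => -[_|m _]; first by rewrite stop0 !integral_set0 mule0.
rewrite !stopI//; last exact: measurableI.
rewrite -ge0_integralZl//; first last.
- by move=> a _; apply: integral_ge0 => b _; rewrite lee_fin.
- apply: (@measurable_fun_fubini_tonelli_F _ _ _ _ _ _
      (fun ab => (\1_(stop m.+1) ab.1 * \1_A (glue m.+1 ab))%:E)).
  + apply/measurable_EFinP; apply: measurable_funM.
      by apply: (measurableT_comp _ measurable_fst).
    by apply: (measurableT_comp _ (measurable_glue _)).
  + by move=> ab; rewrite lee_fin.
apply: eq_integral => a _.
have mAa : measurable [set b | A (glue m.+1 (a, b))].
  by rewrite -[X in measurable X]setTI; exact: measurable_glue2.
(* On [stop m.+1], [theta] maps the glued path to b, so by invariance the glued path lies in I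
   exactly when b does. *)
transitivity ((\1_(stop m.+1) a)%:E *
    Q ([set b | A (glue m.+1 (a, b))] `&` I))%E.
  have [sa|sa] := boolP (a \in stop m.+1); last first.
    rewrite indicE (negbTE sa) mul0e; apply: integral0_eq => b _.
    by rewrite mul0r.
  rewrite indicE sa mul1e QE; last exact: measurableI.
  apply: eq_integral => b _; rewrite mul1r !indicE; congr (_%:R%:E).
  congr nat_of_bool; rewrite !in_setI; congr andb.
  apply/idP/idP; rewrite !in_setE //= => h; move: (h).
    rewrite -{1}tI /= (theta_stop (m := m.+1)) ?shift_glue//.
    apply: (stop_agree (agreeC (agree_glue (a,b)))).
    by rewrite in_setE in sa.
  rewrite -{2}tI /= (theta_stop (m := m.+1)) ?shift_glue//.
  apply: (stop_agree (agreeC (agree_glue (a,b)))).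
  by rewrite in_setE in sa.
(* The subtraction is truncated: if [m.+1] exceeds n, then a alone decides A and no block of b is
   read. *)
rewrite (IH (n - m.+1)%N)//; last 2 first.
- lia.
- move=> b b' bb /=; apply: An => j jn; rewrite /glue; case: ifPn => //=.
  by rewrite -leqNgt => mj; apply: bb => /=; lia.
rewrite IE muleA muleC; congr (_ * _)%E.
have [sa|sa] := boolP (a \in stop m.+1); last first.
  rewrite [\1_(stop _) a]indicE (negbTE sa) mul0e; apply/esym/integral0_eq => b _.
  by rewrite mul0r.
rewrite [\1_(stop _) a]indicE sa mul1e QE//.
by apply: eq_integral => b _; rewrite mul1r.
Qed.

(* An invariant event is independent of every cylinder, hence of itself. *)
Lemma stop_ergodic (I : set W) : measurable I -> theta @^-1` I = I ->
  Q I = 0%E \/ Q I = 1%E.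
Proof.
move=> mI tI.
have r0 : 0 <= fine (Q I) by rewrite fine_ge0.
have IE : Q I = (fine (Q I))%:E by rewrite fineK// fin_num_measure.
have : mrestr Q mI I = mscale (NngNum r0) Q I.
  apply: (@path_measure_unique R _ (mrestr Q mI) (mscale (NngNum r0) Q)) => //.
    move=> s A us mA.
    change (Q (cylinder s A `&` I) = ((fine (Q I))%:E * Q (cylinder s A))%E).
    rewrite (@invariant_independent (\max_(j <- s) j.1.+1)%N)//.
    - by rewrite muleC -IE.
    - apply: sub_sigma_algebra; by exists s, A.
    - move=> w w' ww ws j js; rewrite -ww; first exact: ws.
      exact: (@leq_bigmax_seq _ s xpredT (fun j : block_index K => j.1.+1)).
  by change (Q (setT `&` I) < +oo)%E; rewrite setTI IE ltry.
rewrite /mrestr /mscale/= setIid -IE.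
have [q ->] : exists q, Q I = q%:E by eexists; exact: IE.
move=> [] /eqP.
rewrite -subr_eq0 -{1}[q]mulr1 -mulrBr mulf_eq0 subr_eq0 => /orP[/eqP->|/eqP <-].
  by left.
by right.
Qed.

End block_paths.

(** * Order statistics *)

Section order_statistics.
Context (R : realType) (n : nat).
Implicit Types (x : 'I_n -> R) (s : {perm 'I_n}).

Lemma reached_before_irr x s i : ~~ reached_before x s i i.
Proof. by rewrite /reached_before ltxx ltnn eqxx. Qed.

Lemma reached_before_trans x s : transitive (reached_before x s).
Proof.
move=> j i l; rewrite /reached_before.
move=> /orP[ij|/andP[/eqP ij sij]] /orP[jl|/andP[/eqP jl sjl]].
- by rewrite (lt_trans ij jl).
- by rewrite -jl ij.
- by rewrite ij jl.
- by rewrite ij jl eqxx (ltn_trans sij sjl) orbT.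
Qed.

Lemma reached_before_total x s i j :
  i != j -> reached_before x s i j || reached_before x s j i.
Proof.
move=> ij; rewrite /reached_before; case: (ltgtP (x i) (x j)) => //= _.
have : (s i != s j :> nat) by rewrite (inj_eq val_inj) (inj_eq perm_inj).
by rewrite neq_ltn.
Qed.

(** The position, from 0, in the strict total order [reached_before]. Ties being resolved by s, the
    rank is a bijection even when delays coincide. *)
Definition rank_of x s i : nat := #|[pred j | reached_before x s j i]|.

Lemma among_earliestE k x s i : among_earliest k x s i = (rank_of x s i < k)%N.
Proof. by []. Qed.

Lemma ltn_rank_of x s i j : reached_before x s i j -> (rank_of x s i < rank_of x s j)%N.
Proof.
move=> ij; apply: proper_card; apply/properP; split.
  by apply/fintype.subsetP => l; rewrite !inE => li; exact: reached_before_trans li ij.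
by exists i; rewrite !inE// (negbTE (reached_before_irr _ _ _)).
Qed.

Lemma rank_of_lt x s i : (rank_of x s i < n)%N.
Proof.
rewrite -[n in X in (_ < X)%N]card_ord; apply: proper_card; apply/properP; split.
  exact/fintype.subsetP.
by exists i => //; rewrite inE (negbTE (reached_before_irr _ _ _)).
Qed.

Lemma rank_of_inj x s : injective (rank_of x s).
Proof.
move=> i j e; apply/eqP/negPn/negP => /(reached_before_total x s).
by move=> /orP[] /ltn_rank_of; rewrite e ltnn.
Qed.

Definition rank_ord x s i : 'I_n := Ordinal (rank_of_lt x s i).

Lemma rank_ord_bij x s : bijective (rank_ord x s).
Proof.
apply: injF_bij => i j /(congr1 val) /= ; exact: rank_of_inj.
Qed.

(** The delays read in the order of ranks form a sorted rearrangement of all delays, and such a list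
    is unique. *)
Lemma order_stat_rank x s i : order_stat x (rank_of x s i).+1 = x i.
Proof.
have [g gK Kg] := rank_ord_bij x s.
rewrite /order_stat /=.
pose L := [seq x (g j) | j <- enum 'I_n].
have -> : sort <=%R (codom x) = L.
  apply: (sorted_eq le_trans le_anti).
  - exact: (sort_sorted le_total).
  - have : sorted ltn [seq val j | j <- enum 'I_n].
      by rewrite val_enum_ord iota_ltn_sorted.
    rewrite /L !sorted_map; apply: sub_sorted => a b /= ab.
    have : ~~ reached_before x s (g b) (g a).
      apply/negP => /ltn_rank_of.
      rewrite -[rank_of x s (g b)]/(val (rank_ord x s (g b))).
      rewrite -[rank_of x s (g a)]/(val (rank_ord x s (g a))) !Kg.
      by rewrite ltnNge (ltnW ab).
    by rewrite /reached_before negb_or -leNgt => /andP[].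
  - rewrite perm_sort /L /codom /image_mem.
    rewrite (_ : [seq x (g j) | j <- enum 'I_n] = map x (map g (enum 'I_n))).
      2: by rewrite -map_comp.
    apply: perm_map; apply: uniq_perm.
    + by rewrite enum_uniq.
    + by rewrite map_inj_uniq ?enum_uniq//; exact: (can_inj Kg).
    + move=> l; rewrite mem_enum; apply/esym/mapP.
      by exists (rank_ord x s l); rewrite ?mem_enum// gK.
rewrite /L -[rank_of x s i]/(nat_of_ord (rank_ord x s i)).
by rewrite (nth_map (rank_ord x s i)) ?size_enum_ord// nth_ord_enum gK.
Qed.

(** An order statistic as a finite sum, from which its measurability is read off. Its value does not
    depend on the tie-breaking, so the identity permutation is used. *)
Lemma order_statE k x : (0 < k <= n)%N ->
  order_stat x k = \sum_(i < n) (rank_of x 1 i == k.-1)%:R * x i.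
Proof.
move=> /andP[k0 kn].
have kn' : (k.-1 < n)%N by rewrite prednK.
have [g gK Kg] := rank_ord_bij x 1.
pose i := g (Ordinal kn').
have ri : rank_of x 1 i = k.-1.
  by rewrite -[LHS]/(val (rank_ord x 1 i)) /i Kg.
rewrite (bigD1 i)//= big1 => [|j ji].
  by rewrite ri eqxx mul1r addr0 -[in RHS](order_stat_rank x 1) ri prednK.
rewrite -ri (inj_eq (@rank_of_inj x 1)).
by rewrite (negbTE ji) mul0r.
Qed.

Lemma order_stat_ex x k : (0 < k <= n)%N -> exists i, order_stat x k = x i.
Proof.
move=> /andP[k0 kn]; have kn' : (k.-1 < n)%N by rewrite prednK.
have [g gK Kg] := rank_ord_bij x 1.
exists (g (Ordinal kn')); have := order_stat_rank x 1 (g (Ordinal kn')).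
by rewrite -[rank_of x 1 _]/(val (rank_ord x 1 _)) Kg /= prednK.
Qed.

Lemma among_earliest_le k x s i : (0 < k <= n)%N -> among_earliest k x s i ->
  x i <= order_stat x k.
Proof.
move=> /andP[k0 kn]; rewrite among_earliestE => rk.
have kn' : (k.-1 < n)%N by rewrite prednK.
have [g gK Kg] := rank_ord_bij x s.
have := order_stat_rank x s (g (Ordinal kn')).
rewrite -[rank_of x s _]/(val (rank_ord x s _)) Kg /= prednK// => ->.
have : ~~ reached_before x s (g (Ordinal kn')) i.
  apply/negP => /ltn_rank_of.
  rewrite -[rank_of x s (g _)]/(val (rank_ord x s _)) Kg /= => h.
  by move: h rk; lia.
by rewrite /reached_before negb_or -leNgt => /andP[].
Qed.

(** Reindexing the nodes by their rank turns the selected ones into the positions below k. *)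
Lemma sum_among_earliest k x s : (k <= n)%N ->
  \sum_(i < n) (among_earliest k x s i)%:R * x i =
  \sum_(1 <= j < k.+1) order_stat x j.
Proof.
move=> kn; have [g gK Kg] := rank_ord_bij x s.
rewrite (reindex_onto g (rank_ord x s))/=; last by move=> i _; rewrite gK.
under eq_bigl do rewrite Kg eqxx.
rewrite big_add1 /=.
rewrite (big_nat_widen _ _ n)//= big_mkord [RHS]big_mkcond/=.
apply: eq_bigr => j _.
have rj : rank_of x s (g j) = j.
  by rewrite -[LHS]/(val (rank_ord x s _)) Kg.
rewrite among_earliestE rj; case: ifP => _; last by rewrite mul0r.
by rewrite mul1r -[in RHS]rj order_stat_rank.
Qed.

Lemma card_among_earliest k x s : (k <= n)%N ->
  \sum_(i < n) (among_earliest k x s i)%:R = k%:R :> R.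
Proof.
move=> kn; have [g gK Kg] := rank_ord_bij x s.
rewrite (reindex_onto g (rank_ord x s))/=; last by move=> i _; rewrite gK.
under eq_bigl do rewrite Kg eqxx.
under eq_bigr => j _.
  rewrite among_earliestE -[rank_of x s (g j)]/(val (rank_ord x s _)) Kg /=.
  over.
transitivity (\sum_(j < n | (j < k)%N) 1 : R).
  by rewrite [RHS]big_mkcond; apply: eq_bigr => j _; case: ifP.
by rewrite -(big_ord_widen n (fun=> 1) kn) sumr_const card_ord.
Qed.

Lemma order_stat_gt0 k x : (0 < k <= n)%N -> (forall i, 0 < x i) ->
  0 < order_stat x k.
Proof. by move=> /(order_stat_ex x)[i ->]. Qed.

(** Since [(t * s) i = s (t i)], the relabelled node i inherits both the delay and the tie-breaking
    value of [t i]. *)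
Lemma reached_before_perm x s (t : {perm 'I_n}) i j :
  reached_before (fun l => x (t l)) (t * s)%g i j = reached_before x s (t i) (t j).
Proof. by rewrite /reached_before !permM. Qed.

Lemma rank_of_perm x s (t : {perm 'I_n}) i :
  rank_of (fun l => x (t l)) (t * s)%g i = rank_of x s (t i).
Proof.
rewrite /rank_of -!sum1_card [RHS](reindex_inj (@perm_inj _ t)).
by apply: eq_bigl => j; rewrite !inE reached_before_perm.
Qed.

Lemma order_stat_perm k x (t : {perm 'I_n}) : (0 < k <= n)%N ->
  order_stat (fun l => x (t l)) k = order_stat x k.
Proof.
move=> /andP[k0 kn]; have kn' : (k.-1 < n)%N by rewrite prednK.
have [g gK Kg] := rank_ord_bij (fun l => x (t l)) (t * 1)%g.
have ri : rank_of (fun l => x (t l)) (t * 1)%g (g (Ordinal kn')) = k.-1.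
  by rewrite -[LHS]/(val (rank_ord _ _ _)) Kg.
have := order_stat_rank x 1 (t (g (Ordinal kn'))).
rewrite -rank_of_perm ri prednK// => ->.
by rewrite -{1}(prednK k0) -{1}ri order_stat_rank.
Qed.

End order_statistics.

(** * Service cycles *)

Definition node_index (n : nat) : eqType := [the eqType of ('I_n + bool)%type].

Section path_model.
Context (R : realType) (n k : nat).
Local Notation W := (path R (block_index (node_index n))).
Implicit Types w : W.

(* The default value makes the quantities below positive on every path, while
   almost surely it is never used. *)
Definition pos (y : R) : R := if 0 < y then y else 1.

(** Permutations become reals in order to be coordinates of a path; reals that code nothing are
    decoded as the identity. *)
Definition tie_code (p : {perm 'I_n}) : R := (enum_rank p)%:R.
Definition tie_decode (y : R) : {perm 'I_n} :=
  odflt 1%g [pick p | y == tie_code p].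

(* Block m of a path holds the delays and the tie-breaking of update m,
   followed by the interarrival time between updates m and m+1. *)
Definition delay w (m : nat) (i : 'I_n) : R := pos (w (m, inl i)).
Definition gap w (m : nat) : R := pos (w (m, inr false)).
Definition tie w (m : nat) : {perm 'I_n} := tie_decode (w (m, inr true)).

Definition service w : R := order_stat (delay w 0) k.
Definition elapsed (l : nat) w : R := \sum_(0 <= j < l) gap w j.
(** Update m is the first to arrive after the completion, and the cycle consumes m blocks. The weak
    inequality drops an arrival exactly at the completion. For [m = 0] both bounds are 0 and the
    event is empty. *)
Definition stop (m : nat) : set W :=
  [set w | elapsed m.-1 w <= service w < elapsed m w].
(** If no m qualifies, the default 0 makes [next_cycle] the identity and [cycle_time] zero. *)
Definition cycle_length w : nat := xget 0%N [set m | stop m w].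
Definition next_cycle w : W := shift (cycle_length w) w.
Definition cycle_time w : R := elapsed (cycle_length w) w.
Definition hit (i : 'I_n) w : bool := among_earliest k (delay w 0) (tie w 0) i.

Lemma pos_gt0 y : 0 < pos y.
Proof. by rewrite /pos; case: ifP. Qed.

Lemma tie_codeK : cancel tie_code tie_decode.
Proof.
move=> p; rewrite /tie_decode; case: pickP => [q|/(_ p)]; last by rewrite eqxx.
by rewrite /tie_code eqr_nat => /eqP/val_inj/enum_rank_inj ->.
Qed.

Lemma delay_gt0 w m i : 0 < delay w m i. Proof. exact: pos_gt0. Qed.
Lemma gap_gt0 w m : 0 < gap w m. Proof. exact: pos_gt0. Qed.

Lemma delay_shift l w m : delay (shift l w) m = delay w (l + m). Proof. by []. Qed.
Lemma gap_shift l w m : gap (shift l w) m = gap w (l + m). Proof. by []. Qed.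
Lemma tie_shift l w m : tie (shift l w) m = tie w (l + m). Proof. by []. Qed.

Lemma elapsedS l w : elapsed l.+1 w = elapsed l w + gap w l.
Proof. by rewrite /elapsed big_nat_recr. Qed.

Lemma elapsed0 w : elapsed 0 w = 0.
Proof. by rewrite /elapsed big_geq. Qed.

Lemma elapsed_le w : {homo elapsed^~ w : l m / (l <= m)%N >-> l <= m}.
Proof.
by apply/nondecreasing_seqP => l; rewrite elapsedS lerDl ltW// gap_gt0.
Qed.

Lemma elapsed_ge0 l w : 0 <= elapsed l w.
Proof. by rewrite -(elapsed0 w); exact: elapsed_le. Qed.

Hypothesis kn : (0 < k <= n)%N.

Lemma service_gt0 w : 0 < service w.
Proof. by apply: order_stat_gt0 => // i; exact: delay_gt0. Qed.

Lemma stop0 : stop 0 = set0.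
Proof.
apply/seteqP; split => // w /= /andP[_].
by rewrite elapsed0 ltNge ltW// service_gt0.
Qed.

Lemma stop_inj w l m : stop l w -> stop m w -> l = m.
Proof.
have H a b : stop a w -> stop b w -> (a <= b)%N.
  move=> /andP[+ _] /andP[_ sb] => sa; rewrite leqNgt; apply/negP => ba.
  have := lt_le_trans sb (elapsed_le w (_ : b <= a.-1)%N).
  by move=> /(_ (ltac:(lia)))/(fun h => lt_le_trans h sa); rewrite ltxx.
by move=> sl sm; apply/eqP; rewrite eqn_leq !H.
Qed.

Lemma stop_trivIset : trivIset setT stop.
Proof. by move=> l m _ _ [w [lw mw]]; exact: stop_inj lw mw. Qed.

Lemma cycle_lengthE m w : stop m w -> cycle_length w = m.
Proof.
move=> mw; rewrite /cycle_length; case: xgetP => [l _ lw|/(_ m)//].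
exact: stop_inj lw mw.
Qed.

Lemma next_cycleE m w : stop m w -> next_cycle w = shift m w.
Proof. by move=> mw; rewrite /next_cycle (cycle_lengthE mw). Qed.

Lemma cycle_timeE m w : stop m w -> cycle_time w = elapsed m w.
Proof. by move=> mw; rewrite /cycle_time (cycle_lengthE mw). Qed.

Lemma exists_stop w : (exists l, service w < elapsed l w) -> exists m, stop m w.
Proof.
move=> ex; case: (ex_minnP ex) => -[|m] lt_m min_m.
  by move: lt_m; rewrite elapsed0 ltNge ltW// service_gt0.
exists m.+1; rewrite /stop /= lt_m andbT leNgt; apply/negP => /min_m.
by rewrite ltnn.
Qed.

Lemma agree_elapsed m w w' l : (l <= m)%N -> agree m w w' ->
  elapsed l w = elapsed l w'.
Proof.
move=> lm ww; rewrite /elapsed; apply: eq_big_nat => j /andP[_ jl].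
by rewrite /gap ww//= (leq_trans jl).
Qed.

Lemma agree_delay m w w' : (0 < m)%N -> agree m w w' -> delay w 0 = delay w' 0.
Proof. by move=> m0 ww; apply/funext => i; rewrite /delay ww. Qed.

Lemma agree_tie m w w' : (0 < m)%N -> agree m w w' -> tie w 0 = tie w' 0.
Proof. by move=> m0 ww; rewrite /tie ww. Qed.

Lemma agree_service m w w' : (0 < m)%N -> agree m w w' -> service w = service w'.
Proof. by move=> m0 ww; rewrite /service (agree_delay m0 ww). Qed.

Lemma agree_hit m w w' i : (0 < m)%N -> agree m w w' -> hit i w = hit i w'.
Proof. by move=> m0 ww; rewrite /hit (agree_delay m0 ww) (agree_tie m0 ww). Qed.

Lemma stop_gt0 m w : stop m w -> (0 < m)%N.
Proof. by case: m => //; rewrite stop0. Qed.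

Lemma stop_agree m w w' : agree m w w' -> stop m w -> stop m w'.
Proof.
move=> ww mw; have m0 := stop_gt0 mw.
rewrite /stop /= -(agree_service m0 ww).
by rewrite -(agree_elapsed (leq_pred m) ww) -(agree_elapsed (leqnn m) ww).
Qed.

Lemma agree_cycle_time m w w' : agree m w w' -> stop m w ->
  cycle_time w = cycle_time w'.
Proof.
move=> ww mw; rewrite (cycle_timeE mw) (cycle_timeE (stop_agree ww mw)).
exact: agree_elapsed ww.
Qed.

Lemma cycle_time_ge0 w : 0 <= cycle_time w.
Proof. exact: elapsed_ge0. Qed.

Lemma measurable_pos : measurable_fun setT pos.
Proof.
apply: measurable_fun_ifT => //.
exact: measurable_fun_ltr.
Qed.

Lemma measurable_delay m i : measurable_fun setT (fun w => delay w m i).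
Proof. exact: (measurableT_comp measurable_pos (measurable_coord _)). Qed.

Lemma measurable_gap m : measurable_fun setT (fun w => gap w m).
Proof. exact: (measurableT_comp measurable_pos (measurable_coord _)). Qed.

Lemma measurable_elapsed l : measurable_fun setT (elapsed l).
Proof. by apply: measurable_sum => j; exact: measurable_gap. Qed.

(** A permutation other than 1 is decoded from its code only; 1 is also the default, so its preimage
    is the complement of the other codes. *)
Lemma measurable_tie_decode p : measurable [set y : R | tie_decode y = p].
Proof.
have fin (A : set {perm 'I_n}) : measurable (\bigcup_(q in A) [set tie_code q]).
  by apply: fin_bigcup_measurable => //; exact: finite_finset.
have [->|p1] := eqVneq p 1%g.
  rewrite [X in measurable X](_ : _ =
      ~` \bigcup_(q in [set q | q != 1%g]) [set tie_code q]).
    by apply: measurableC; exact: fin.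
  apply/seteqP; split => y /=.
    by move=> y1 [q /= q1 yq]; move: y1; rewrite yq tie_codeK => /eqP; rewrite (negbTE q1).
  move=> yN; rewrite /tie_decode; case: pickP => //= q /eqP yq.
  by apply/eqP/negPn/negP => q1; apply: yN; exists q.
rewrite [X in measurable X](_ : _ = [set tie_code p])//.
apply/seteqP; split => y /=; last by move=> ->; rewrite tie_codeK.
rewrite /tie_decode; case: pickP => [q /eqP -> /= -> //|_ /= e].
by rewrite -e eqxx in p1.
Qed.

Lemma measurable_tie m (f : {perm 'I_n} -> bool) :
  measurable_fun setT (fun w => f (tie w m)).
Proof.
apply: (measurable_fun_bool true); rewrite setTI.
rewrite [X in measurable X](_ : _ =
  \bigcup_(p in [set p | f p]) [set w : W | tie w m = p]).
  apply: fin_bigcup_measurable => [|p _]; first exact: finite_finset.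
  have := @measurable_coord R (block_index (node_index n)) (m, inr true) measurableT
    _ (measurable_tie_decode p).
  by rewrite setTI.
apply/seteqP; split => w /=; first by move=> fw; exists (tie w m).
by move=> [p /= fp ->].
Qed.

Lemma measurable_bool_natr d (X : measurableType d) (b : X -> bool) :
  measurable_fun setT b -> measurable_fun setT (fun v => (b v)%:R : R).
Proof.
move=> mb; rewrite [X in measurable_fun _ X](_ : _ = fun v => if b v then 1 else 0 : R).
  exact: measurable_fun_ifT.
by apply/funext => v; case: (b v).
Qed.

Lemma measurable_rank_of d (X : measurableType d) (x : X -> 'I_n -> R)
    (s : X -> {perm 'I_n}) i :
  (forall j, measurable_fun setT (fun v => x v j)) ->
  (forall f : {perm 'I_n} -> bool, measurable_fun setT (fun v => f (s v))) ->
  measurable_fun setT (fun v => (rank_of (x v) (s v) i)%:R : R).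
Proof.
move=> mx ms.
rewrite [X in measurable_fun _ X](_ : _ =
    fun v => \sum_(j < n) (reached_before (x v) (s v) j i)%:R : R).
  apply: measurable_sum => j; apply: measurable_bool_natr.
  apply: measurable_or; first exact: measurable_fun_ltr.
  apply: measurable_and; first exact: measurable_fun_eqr.
  exact: (ms (fun p => (p j < p i)%N)).
apply/funext => v; rewrite /rank_of -sum1_card natr_sum big_mkcond/=.
by apply: eq_bigr => j _; rewrite inE; case: ifP.
Qed.

Lemma measurable_order_stat d (X : measurableType d) (x : X -> 'I_n -> R) l :
  (0 < l <= n)%N -> (forall j, measurable_fun setT (fun v => x v j)) ->
  measurable_fun setT (fun v => order_stat (x v) l).
Proof.
move=> ln mx.
under [X in measurable_fun _ X]eq_fun do rewrite order_statE//.
apply: measurable_sum => i; apply: measurable_funM => //.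
under [X in measurable_fun _ X]eq_fun do rewrite -(@eqr_nat R).
apply: measurable_bool_natr; apply: measurable_fun_eqr => //.
exact: measurable_rank_of.
Qed.

Lemma measurable_service : measurable_fun setT service.
Proof. by apply: measurable_order_stat => // j; exact: measurable_delay. Qed.

Lemma measurable_hit i : measurable_fun setT (hit i).
Proof.
rewrite [X in measurable_fun _ X](_ : _ = fun w =>
    (rank_of (delay w 0) (tie w 0) i)%:R < (k%:R : R)).
  apply: measurable_fun_ltr => //; apply: measurable_rank_of.
    by move=> j; exact: measurable_delay.
  exact: measurable_tie.
by apply/funext => w; rewrite ltr_nat.
Qed.

Lemma measurable_stop m : measurable (stop m).
Proof.
apply: measurable_set_bool; apply: measurable_and.
  by apply: measurable_fun_ler; [exact: measurable_elapsed|exact: measurable_service].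
by apply: measurable_fun_ltr; [exact: measurable_service|exact: measurable_elapsed].
Qed.

Lemma measurable_cycle_lengthE m : measurable [set w | cycle_length w = m].
Proof.
(* The value m is taken exactly on [stop m], except that 0 is also the default of [xget], taken
   outside all the events [stop l]. *)
have [e|m0] := pselect (exists w, cycle_length w = m /\ ~ stop m w); last first.
  rewrite [X in measurable X](_ : _ = stop m); first exact: measurable_stop.
  apply/seteqP; split => w; last exact: cycle_lengthE.
  by move=> /= wm; apply: contrapT => h; apply: m0; exists w.
have -> : m = 0%N.
  move: e => [w [<-]]; rewrite /cycle_length; by case: xgetP.
rewrite [X in measurable X](_ : _ = ~` \bigcup_m stop m).
  by apply: measurableC; apply: bigcupT_measurable => l; exact: measurable_stop.
apply/seteqP; split => w /=.
  move=> w0 [l _ lw]; have := cycle_lengthE lw; rewrite w0 => l0.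
  by move: lw; rewrite -l0 stop0.
move=> h; rewrite /cycle_length; case: xgetP => // l _ lw.
by exfalso; apply: h; exists l.
Qed.

Lemma measurable_at_cycle d (V : measurableType d) (F : nat -> W -> V) :
  (forall m, measurable_fun setT (F m)) ->
  measurable_fun setT (fun w => F (cycle_length w) w).
Proof.
move=> mF _ A mA; rewrite setTI.
rewrite [X in measurable X](_ : _ =
   \bigcup_m ([set w | cycle_length w = m] `&` F m @^-1` A)).
  apply: bigcupT_measurable => m; apply: measurableI.
    exact: measurable_cycle_lengthE.
  by rewrite -[X in measurable X]setTI; exact: mF.
apply/seteqP; split => w /=; first by move=> Aw; exists (cycle_length w).
by move=> [m _ [<-]].
Qed.

Lemma measurable_next_cycle : measurable_fun setT next_cycle.
Proof. by apply: measurable_at_cycle => m; exact: measurable_shift. Qed.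

Lemma measurable_cycle_time : measurable_fun setT cycle_time.
Proof. by apply: measurable_at_cycle => m; exact: measurable_elapsed. Qed.

End path_model.

(** * Finiteness of integrals of nonnegative functions *)

Section ge0_integrals.
Context d (T : measurableType d) (R : realType) (mu : {measure set T -> \bar R}).

Lemma ge0_integral_ltoo_le (f g : T -> R) : measurable_fun setT f ->
  measurable_fun setT g -> (forall x, 0 <= f x <= g x) ->
  (\int[mu]_x (g x)%:E < +oo -> \int[mu]_x (f x)%:E < +oo)%E.
Proof.
move=> mf mg fg; apply: le_lt_trans; apply: ge0_le_integral => //.
- by move=> x _; rewrite lee_fin; case/andP: (fg x).
- exact/measurable_EFinP.
- exact/measurable_EFinP.
- by move=> x _; rewrite lee_fin; case/andP: (fg x).
Qed.

Lemma ge0_integralD_ltoo (f g : T -> R) : measurable_fun setT f ->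
  measurable_fun setT g -> (forall x, 0 <= f x) -> (forall x, 0 <= g x) ->
  (\int[mu]_x (f x)%:E < +oo -> \int[mu]_x (g x)%:E < +oo ->
   \int[mu]_x (f x + g x)%:E < +oo)%E.
Proof.
move=> mf mg f0 g0 fi gi; under eq_integral do rewrite EFinD.
rewrite ge0_integralD//; first exact: lte_add_pinfty.
- by move=> x _; rewrite lee_fin.
- exact/measurable_EFinP.
- by move=> x _; rewrite lee_fin.
- exact/measurable_EFinP.
Qed.

Lemma ge0_integralZl_ltoo (f : T -> R) (a : R) : measurable_fun setT f ->
  (forall x, 0 <= f x) -> 0 <= a ->
  (\int[mu]_x (f x)%:E < +oo -> \int[mu]_x (a * f x)%:E < +oo)%E.
Proof.
move=> mf f0 a0 fi; under eq_integral do rewrite EFinM.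
rewrite ge0_integralZl_EFin//; last exact/measurable_EFinP.
  by rewrite lte_mul_pinfty.
by move=> x _; rewrite lee_fin.
Qed.

Lemma ge0_integrable_ltoo (f : T -> R) : measurable_fun setT f ->
  (forall x, 0 <= f x) ->
  (\int[mu]_x (f x)%:E < +oo)%E -> mu.-integrable setT (EFin \o f).
Proof.
move=> mf f0 fi; apply/integrableP; split; first exact/measurable_EFinP.
by under eq_integral => x _ do rewrite /= ger0_norm//.
Qed.

End ge0_integrals.

(** * Finite second moment of the cycle time *)

Section moments.
Context (R : realType) (n k : nat).
Local Notation W := (path R (block_index (node_index n))).
Hypothesis kn : (0 < k <= n)%N.
Variable Q : probability W R.
Variable nu : node_index n -> set R -> \bar R.
Hypothesis Q_cylinder : forall s A, uniq s -> (forall j, measurable (A j)) ->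
  Q (cylinder s A) = (\prod_(j <- s) nu j.2 (A j))%E.
Hypothesis gap2 : (\int[Q]_w (gap w 0 ^+ 2)%:E < +oo)%E.
Hypothesis delay2 : forall i, (\int[Q]_w (delay w 0 i ^+ 2)%:E < +oo)%E.

Let Q1 : Q [set: W] = 1%E. Proof. exact: probability_setT. Qed.

Let integral1_ltoo : (\int[Q]_w (1 : R)%:E < +oo)%E.
Proof. by rewrite integral_cst// mul1e [X in (X < _)%E]Q1 ltry. Qed.

Lemma ltoo_of_square (f : W -> R) : measurable_fun setT f ->
  (forall w, 0 <= f w) ->
  (\int[Q]_w (f w ^+ 2)%:E < +oo -> \int[Q]_w (f w)%:E < +oo)%E.
Proof.
move=> mf f0 f2.
apply: (@ge0_integral_ltoo_le _ _ _ Q f (fun w => 1 + f w ^+ 2)) => //.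
- by apply: measurable_funD => //; exact: measurable_funX.
- by move=> w; rewrite f0/=; have := sqr_ge0 (f w - 1); rewrite sqrrB1; have := f0 w; nra.
apply: ge0_integralD_ltoo => //.
- exact: measurable_funX.
- by move=> w; rewrite sqr_ge0.
Qed.

Lemma service2 : (\int[Q]_w (service k w ^+ 2)%:E < +oo)%E.
Proof.
have md i : measurable_fun setT (fun w : W => delay w 0 i ^+ 2).
  by apply: measurable_funX; exact: measurable_delay.
apply: (@ge0_integral_ltoo_le _ _ _ Q _ (fun w => \sum_(i < n) delay w 0 i ^+ 2)).
- by apply: measurable_funX; exact: measurable_service.
- exact: measurable_sum.
- move=> w; rewrite sqr_ge0/= /service order_statE//.
  have [i ->] : exists i, \sum_(i < n) (rank_of (delay w 0) 1 i == k.-1)%:R * delay w 0 i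
       = delay w 0 i.
    have [i e] := order_stat_ex (delay w 0) kn.
    by exists i; rewrite -order_statE.
  by rewrite (bigD1 i)//= lerDl sumr_ge0// => j _; rewrite sqr_ge0.
under eq_integral do rewrite -sumEFin.
rewrite ge0_integral_sum//.
- by apply: lte_sum_pinfty => i _; exact: delay2.
- by move=> i; exact/measurable_EFinP.
- by move=> i w _; rewrite lee_fin sqr_ge0.
Qed.

Lemma service1 : (\int[Q]_w (service k w)%:E < +oo)%E.
Proof.
apply: ltoo_of_square; [exact: measurable_service| |exact: service2].
by move=> w; rewrite ltW// service_gt0.
Qed.

(** Update l arrives no later than the completion, so gap l belongs to the cycle. The event is known
    from the first l blocks and hence independent of [gap w l]. *)
Definition late (l : nat) (w : W) : bool := elapsed l w <= service k w.

Lemma lateS l w : late l.+1 w -> late l w.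
Proof. by apply: le_trans; apply: elapsed_le. Qed.

Lemma agree_late l w w' : agree l w w' -> late l w = late l w'.
Proof.
(* For [l = 0] the paths share no block and their service times may differ, but both are late
   because service times are positive. *)
case: l => [_|l ww].
  by rewrite /late !elapsed0 !ltW// service_gt0.
by rewrite /late (agree_elapsed (leqnn _) ww) (agree_service _ (ltn0Sn l) ww).
Qed.

Lemma measurable_late l : measurable_fun setT (late l).
Proof. by apply: measurable_fun_ler; [exact: measurable_elapsed|exact: measurable_service]. Qed.

Lemma late_integral l (g : R -> R) : measurable_fun setT g -> (forall w : W, 0 <= g (gap w 0)) ->
  (\int[Q]_w ((late l w)%:R * g (gap w l))%:E =
   \int[Q]_w ((late l w)%:R)%:E * \int[Q]_w (g (gap w 0))%:E)%E.
Proof.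
move=> mg g0.
rewrite -(shift_independent Q_cylinder (m := l)).
- by apply: eq_integral => w _; rewrite gap_shift addn0 EFinM.
- by apply/measurable_EFinP; apply: measurable_bool_natr; exact: measurable_late.
- by move=> w; rewrite lee_fin.
- by apply/measurable_EFinP; apply: (measurableT_comp mg); exact: measurable_gap.
- by move=> w; rewrite lee_fin.
- by move=> w w' /agree_late ->.
Qed.

(** All late gaps but the last one fit into the service time, and the truncation at 1 bounds the
    last. *)
Lemma late_sum_le m w :
  \sum_(0 <= l < m) (late l w)%:R * Num.min (gap w l) 1 <= service k w + 1.
Proof.
(* The second conjunct carries the induction: while m is late, the sum is at most the elapsed time
   and so at most the service time. *)
suff [] : \sum_(0 <= l < m) (late l w)%:R * Num.min (gap w l) 1 <= service k w + 1 /\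
  (late m w -> \sum_(0 <= l < m) (late l w)%:R * Num.min (gap w l) 1 <= elapsed m w) by [].
elim: m => [|m [IH1 IH2]].
  rewrite big_geq// elapsed0; split => //.
  by rewrite addr_ge0// ltW// service_gt0.
rewrite big_nat_recr//= elapsedS; case: (boolP (late m w)) => lm.
  rewrite mul1r; split.
    have := IH2 lm; have : elapsed m w <= service k w by [].
    have : Num.min (gap w m) 1 <= 1 by rewrite ge_min lexx orbT.
    lra.
  move=> _; apply: lerD; first exact: IH2.
  by rewrite ge_min lexx.
rewrite mul0r addr0; split => // /lateS.
by rewrite (negbTE lm).
Qed.

(* gap l is independent of late l, so late_sum_le bounds the sum of the
   probabilities of lateness by (E[service] + 1) / E[min(gap, 1)]. *)
Lemma late_prob_bounded : exists C : R, forall m,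
  (\sum_(0 <= l < m) \int[Q]_w ((late l w)%:R)%:E <= C%:E)%E.
Proof.
pose rho : \bar R := (\int[Q]_w (Num.min (gap w 0) 1)%:E)%E.
have mmin l : measurable_fun setT (fun w : W => Num.min (gap w l) 1).
  by apply: measurable_minr => //; exact: measurable_gap.
have min0 (w : W) l : 0 < Num.min (gap w l) 1.
  by rewrite lt_min ltr01 gap_gt0.
have rhooo : (rho < +oo)%E.
  apply: (@ge0_integral_ltoo_le _ _ _ Q _ (cst 1)) => //.
    by move=> w; rewrite ltW//= ge_min lexx orbT.
have rho_gt0 : (0 < rho)%E.
  rewrite lt0e integral_ge0 ?andbT; last by move=> w _; rewrite lee_fin ltW.
  apply/eqP => rho0.
  have : (\int[Q]_w `|(Num.min (gap w 0) 1)%:E| = 0)%E.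
    by rewrite -[RHS]rho0; apply: eq_integral => w _; rewrite gee0_abs// lee_fin ltW.
  move/ae_eq_integral_abs => /(_ measurableT)[]; first exact/measurable_EFinP.
  move=> N [mN N0 sub].
  have : Q setT = 0%E.
    apply/eqP; rewrite -measure_le0 -N0; apply: le_measure; rewrite ?inE//.
    move=> w _; apply: sub => /= /(_ Logic.I)[] h.
    by have := min0 w 0%N; rewrite h ltxx.
  by rewrite [X in X = _ -> _]Q1 => /eqP; rewrite onee_eq0.
have [r r0 rE] : exists2 r : R, 0 < r & rho = r%:E.
  by move: rhooo rho_gt0; case: rho => // r _ r0; exists r.
pose s1 : \bar R := (\int[Q]_w (service k w + 1)%:E)%E.
have s1oo : (s1 < +oo)%E.
  apply: ge0_integralD_ltoo => //; first exact: measurable_service.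
  - by move=> w; rewrite ltW// service_gt0.
  - exact: service1.
have s10 : (0 <= s1)%E.
  by apply: integral_ge0 => w _; rewrite lee_fin addr_ge0// ltW// service_gt0.
exists (fine s1 / r) => m.
have q0 l : (0 <= \int[Q]_w ((late l w)%:R)%:E)%E.
  by apply: integral_ge0 => w _; rewrite lee_fin.
suff H : (\sum_(0 <= l < m) (\int[Q]_w ((late l w)%:R)%:E) * r%:E <= s1)%E.
  rewrite EFinM fineK; last by rewrite ge0_fin_numE.
  rewrite lee_pdivlMr//.
  by rewrite ge0_sume_distrl//; move=> l _; exact: q0.
rewrite -rE.
have mlg l : measurable_fun setT (fun w => (late l w)%:R * Num.min (gap w l) 1).
  apply: measurable_funM => //.
  by apply: measurable_bool_natr; exact: measurable_late.
have lg0 l w : 0 <= (late l w)%:R * Num.min (gap w l) 1.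
  by rewrite mulr_ge0// ltW.
have E l : (\int[Q]_w ((late l w)%:R)%:E * rho =
    \int[Q]_w ((late l w)%:R * Num.min (gap w l) 1)%:E)%E.
  rewrite -(@late_integral l (fun y => Num.min y 1))//; first exact: measurable_minr.
  by move=> w; rewrite ltW.
under eq_bigr => l _ do rewrite E.
rewrite -ge0_integral_sum//; last 2 first.
- by move=> l; exact/measurable_EFinP.
- by move=> l w _; rewrite lee_fin.
apply: ge0_le_integral => //.
- by move=> w _; apply: sume_ge0 => l _; rewrite lee_fin.
- by apply: emeasurable_sum => l; exact/measurable_EFinP.
- by apply/measurable_EFinP; apply: measurable_funD => //; exact: measurable_service.
- by move=> w _; rewrite sumEFin lee_fin; exact: late_sum_le.
Qed.

(** Each lateness probability is at least the probability that all updates are late. The former have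
    bounded partial sums, so the latter is zero. *)
Lemma stop_ae : {ae Q, forall w, exists m, stop k m w}.
Proof.
pose N := \bigcap_l [set w | late l w].
have mlate l : measurable [set w | late l w].
  by apply: measurable_set_bool; exact: measurable_late.
have mN : measurable N by exact: bigcapT_measurable.
exists N; split => //; last first.
  move=> w /= h l _; apply/negPn/negP => /=; rewrite /late -ltNge => hl.
  by apply: h; apply: exists_stop => //; exists l.
have QN l : (Q N <= \int[Q]_w ((late l w)%:R)%:E)%E.
  rewrite [leRHS](_ : _ = \int[Q]_w (\1_[set w | late l w] w)%:E)%E; last first.
    by apply: eq_integral => w _; rewrite indicE mem_setE.
  rewrite integral_indic// setIT; apply: le_measure; rewrite ?inE//.
  by move=> w; apply.
have [C HC] := late_prob_bounded.
have [a a0 aE] : exists2 a : R, 0 <= a & Q N = a%:E.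
  by exists (fine (Q N)); [exact: fine_ge0|rewrite fineK// fin_num_measure].
have [a_eq0|an0] := eqVneq a 0; first by rewrite aE a_eq0.
have [b bC] := exists_natr_gt (C / a).
have agt0 : 0 < a by rewrite lt_neqAle eq_sym an0.
have : ((b%:R * a)%:E <= C%:E)%E.
  apply: le_trans (HC b).
  have -> : (b%:R * a)%:E = (\sum_(0 <= l < b) Q N)%E.
    by rewrite aE sumEFin big_const_nat subn0 iter_addr addr0 mulr_natl.
  by apply: lee_sum => l _; exact: QN.
by rewrite lee_fin -ler_pdivlMr// leNgt bC.
Qed.

(** The cycle is at most the service time plus the last gap, and [(s + g)^2 <= 2 s^2 + 2 g^2]. The
    last gap is late, so its square is a term of the series. *)
Lemma cycle_time_sqr_le w : ((cycle_time k w ^+ 2)%:E <=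
  (2 * service k w ^+ 2)%:E +
  \sum_(0 <= l <oo) (2 * ((late l w)%:R * gap w l ^+ 2))%:E)%E.
Proof.
have t0 l : (0 <= (2 * ((late l w)%:R * gap w l ^+ 2))%:E)%E.
  by rewrite lee_fin mulr_ge0// mulr_ge0// sqr_ge0.
have [[m mw]|/forallNP ns] := pselect (exists m, stop k m w); last first.
  have -> : cycle_time k w = 0.
    rewrite /cycle_time /cycle_length; case: xgetP => [l _ /ns//|_].
    exact: elapsed0.
  rewrite expr0n/= adde_ge0//; first by rewrite lee_fin mulr_ge0// ?sqr_ge0.
  by apply: nneseries_ge0 => l _ _; exact: t0.
rewrite (cycle_timeE kn mw); have m0 := stop_gt0 kn mw.
case: m m0 mw => // m _ /andP[/= lm _].
apply: (@le_trans _ _ ((2 * service k w ^+ 2)%:E + (2 * gap w m ^+ 2)%:E)%E).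
  rewrite -EFinD lee_fin elapsedS.
  have := elapsed_ge0 m w; have := gap_gt0 w m; move: lm.
  move: (elapsed m w) (service k w) (gap w m) => e s g es g0 e0.
  have : (e + g) ^+ 2 <= (s + g) ^+ 2.
    by rewrite ler_sqr ?nnegrE ?addr_ge0 ?(ltW g0) ?(le_trans e0 es)// lerD2r.
  by move=> /le_trans; apply; have := sqr_ge0 (s - g); rewrite sqrrB sqrrD; lra.
rewrite leeD2l//.
apply: (@le_trans _ _ (\sum_(0 <= l < m.+1) (2 * ((late l w)%:R * gap w l ^+ 2))%:E)%E).
  rewrite big_nat_recr//= /late lm mul1r leeDr//.
  by apply: sume_ge0 => l _; exact: t0.
by apply: nneseries_lim_ge => l _ _; exact: t0.
Qed.

(** By independence the series integrates to twice the second moment of a gap times the expected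
    number of late updates, which is finite. *)
Lemma cycle_time2 : (\int[Q]_w (cycle_time k w ^+ 2)%:E < +oo)%E.
Proof.
have ms := measurable_service (R := R) kn.
have mg l : measurable_fun setT (fun w : W => gap w l) by exact: measurable_gap.
have mt l : measurable_fun setT (fun w => (2 * ((late l w)%:R * gap w l ^+ 2))%:E : \bar R).
  apply/measurable_EFinP; apply: measurable_funM => //; apply: measurable_funM => //.
    by apply: measurable_bool_natr; exact: measurable_late.
  exact: measurable_funX.
have t0 l w : (0 <= (2 * ((late l w)%:R * gap w l ^+ 2))%:E :> \bar R)%E.
  by rewrite lee_fin mulr_ge0// mulr_ge0// sqr_ge0.
have m2s : measurable_fun setT (fun w : W => 2 * service k w ^+ 2).
  by apply: measurable_funM => //; exact: measurable_funX.
apply: (@le_lt_trans _ _ (\int[Q]_w ((2 * service k w ^+ 2)%:E +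
  \sum_(0 <= l <oo) (2 * ((late l w)%:R * gap w l ^+ 2))%:E))%E).
  apply: ge0_le_integral => //.
  - by move=> w _; rewrite lee_fin sqr_ge0.
  - by apply/measurable_EFinP/measurable_funX; exact: measurable_cycle_time.
  - apply: emeasurable_funD; first exact/measurable_EFinP.
    by apply: ge0_emeasurable_sum => //; move=> l w _ _; exact: t0.
  - by move=> w _; exact: cycle_time_sqr_le.
rewrite ge0_integralD//; first last.
- by apply: ge0_emeasurable_sum => //; move=> l w _ _; exact: t0.
- by move=> w _; apply: nneseries_ge0 => l _ _; exact: t0.
- exact/measurable_EFinP.
- by move=> w _; rewrite lee_fin mulr_ge0// ?sqr_ge0.
apply: lte_add_pinfty.
  apply: ge0_integralZl_ltoo => //; [exact: measurable_funX|by move=> w; rewrite sqr_ge0|].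
  exact: service2.
rewrite integral_nneseries//.
have [C HC] := late_prob_bounded.
pose g2 := (\int[Q]_w (gap w 0 ^+ 2)%:E)%E.
have g20 : (0 <= g2)%E by apply: integral_ge0 => w _; rewrite lee_fin sqr_ge0.
have g2E : g2 = (fine g2)%:E by rewrite fineK// ge0_fin_numE.
apply: (@le_lt_trans _ _ (2 * (C * fine g2))%:E); last exact: ltry.
apply: lime_le; first by apply: is_cvg_nneseries => l _ _; apply: integral_ge0.
apply: nearW => m.
have E l : (\int[Q]_w (2 * ((late l w)%:R * gap w l ^+ 2))%:E =
    2%:E * (\int[Q]_w ((late l w)%:R)%:E * g2))%E.
  under eq_integral do rewrite EFinM.
  rewrite ge0_integralZl_EFin//.
  - congr (_ * _)%E; apply: (@late_integral l (fun y => y ^+ 2)).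
      exact: measurable_funX.
    by move=> w; rewrite sqr_ge0.
  - by move=> w _; rewrite lee_fin mulr_ge0// ?sqr_ge0.
  - apply/measurable_EFinP; apply: measurable_funM => //; last exact: measurable_funX.
    by apply: measurable_bool_natr; exact: measurable_late.
under eq_bigr do rewrite E.
rewrite -ge0_sume_distrr//; last first.
  move=> l _; apply: mule_ge0 => //; apply: integral_ge0 => w _.
  by rewrite lee_fin.
rewrite -ge0_sume_distrl//; last first.
  by move=> l _; apply: integral_ge0 => w _; rewrite lee_fin.
rewrite EFinM lee_pmul2l// EFinM -g2E; apply: lee_wpmul2r => //.
Qed.

Lemma cycle_time1 : (\int[Q]_w (cycle_time k w)%:E < +oo)%E.
Proof.
apply: ltoo_of_square; [exact: measurable_cycle_time| |exact: cycle_time2].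
exact: cycle_time_ge0.
Qed.

End moments.

(** * Exchangeability of the nodes *)

Section exchangeability.
Context (R : realType) (n k : nat).
Local Notation W := (path R (block_index (node_index n))).
Hypothesis kn : (0 < k <= n)%N.
Variable Q : probability W R.
Variable nu : node_index n -> set R -> \bar R.
Hypothesis Q_cylinder : forall s A, uniq s -> (forall j, measurable (A j)) ->
  Q (cylinder s A) = (\prod_(j <- s) nu j.2 (A j))%E.
Hypothesis nu_delay : forall i i' A, measurable A -> nu (inl i) A = nu (inl i') A.
Hypothesis nu_tie : forall (t : {perm 'I_n}) (A : set R), measurable A ->
  nu (inr true) [set y | A (tie_code R (t * tie_decode n y)%g)] = nu (inr true) A.

Definition relabel_tie (t : {perm 'I_n}) (y : R) : R :=
  tie_code R (t * tie_decode n y)%g.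

(** A cycle reads delays and tie-breaks in block 0 only, so later blocks stay unchanged. The
    tie-breaking is translated along with the delays, so that tied nodes keep their order. *)
Definition relabel (t : {perm 'I_n}) (w : W) : W := fun j =>
  match j with
  | (0%N, inl i) => w (0%N, inl (t i))
  | (0%N, inr true) => relabel_tie t (w (0%N, inr true))
  | _ => w j
  end.

Lemma measurable_relabel_tie t : measurable_fun setT (relabel_tie t).
Proof.
move=> _ A mA; rewrite setTI.
rewrite [X in measurable X](_ : _ =
   \bigcup_(p in [set p | A (tie_code R (t * p)%g)]) [set y : R | tie_decode n y = p]).
  apply: fin_bigcup_measurable => [|p _]; first exact: finite_finset.
  exact: measurable_tie_decode.
apply/seteqP; split => y /=; first by move=> Ay; exists (tie_decode n y).
by move=> [p /= Ap yp]; rewrite /relabel_tie yp.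
Qed.

Lemma measurable_relabel t : measurable_fun setT (relabel t).
Proof.
apply: measurable_path => -[[|m] [i|[]]] /=; try exact: measurable_coord.
exact: (measurableT_comp (measurable_relabel_tie t) (measurable_coord _)).
Qed.

Lemma relabel_preserving t C : measurable C -> Q (relabel t @^-1` C) = Q C.
Proof.
move=> mC; apply: esym.
have := @path_measure_unique R _ Q
  (measure_function_pushforward__canonical__measure_function_Measure
     Q (measurable_relabel t)).
apply=> //; last by rewrite [X in (X < _)%E]probability_setT ltry.
move=> s A us mA.
pose tau (j : block_index (node_index n)) : block_index (node_index n) :=
  match j with (0%N, inl i) => (0%N, inl (t i)) | _ => j end.
have tau_inj : injective tau.
  by move=> [[|m] [i|b]] [[|m'] [i'|b']] //= [] // /perm_inj ->.
(* The relabelled path reads at [inl i] the old coordinate [inl (t i)], so the constraint on an old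
   coordinate comes from the preimage of its node under t. *)
pose A' (j : block_index (node_index n)) : set R :=
  match j with
  | (0%N, inl i) => A (0%N, inl ((t^-1)%g i))
  | (0%N, inr true) => relabel_tie t @^-1` A (0%N, inr true)
  | _ => A j
  end.
have mA' j : measurable (A' j).
  case: j => [[|m] [i|[]]] /=; try exact: mA.
  by rewrite -[X in measurable X]setTI; apply: measurable_relabel_tie.
transitivity (\prod_(j <- s) nu j.2 (A j))%E; first exact: Q_cylinder.
have -> : measure_function_pushforward__canonical__measure_function_Measure
     Q (measurable_relabel t) (cylinder s A) = Q (cylinder (map tau s) A').
  change (Q (relabel t @^-1` cylinder s A) = Q (cylinder (map tau s) A')).
  congr (Q _); apply/seteqP; split => w.
    move=> h _ /mapP[j js ->]; have := h j js.
    by case: j js => [[|m] [i|[]]] js //=; rewrite permK.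
  move=> h j js; have := h (tau j) (map_f tau js).
  by case: j js => [[|m] [i|[]]] js //=; rewrite permK.
rewrite Q_cylinder//; last by rewrite map_inj_uniq.
rewrite big_map; apply: eq_bigr => -[[|m] [i|[]]] _ //=.
  by rewrite permK; exact: nu_delay.
exact/esym/nu_tie.
Qed.

Lemma delay_relabel t w i : delay (relabel t w) 0 i = delay w 0 (t i).
Proof. by []. Qed.

Lemma tie_relabel t w : tie (relabel t w) 0 = (t * tie w 0)%g.
Proof. by rewrite /tie /= /relabel_tie tie_codeK. Qed.

Lemma elapsed_relabel t w l : elapsed l (relabel t w) = elapsed l w.
Proof.
by rewrite /elapsed; apply: eq_bigr => j _; rewrite /gap /relabel; case: j.
Qed.

Lemma service_relabel t w : service k (relabel t w) = service k w.
Proof. exact: (order_stat_perm (delay w 0)). Qed.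

Lemma cycle_time_relabel t w : cycle_time k (relabel t w) = cycle_time k w.
Proof.
rewrite /cycle_time elapsed_relabel; congr (elapsed _ w).
rewrite /cycle_length; congr xget; apply/funext => m.
by rewrite /stop /= !elapsed_relabel service_relabel.
Qed.

Lemma hit_relabel t w i : hit k i (relabel t w) = hit k (t i) w.
Proof.
rewrite /hit !among_earliestE tie_relabel; congr (_ < _)%N.
exact: (rank_of_perm (delay w 0)).
Qed.

(** Relabelling by a transposition shows that all nodes have the same integral; the sum over the
    nodes can be evaluated path by path for the [phi] used below. *)
Lemma hit_integral (phi : 'I_n -> W -> R) i0 :
  (forall i, measurable_fun setT (phi i)) -> (forall i w, 0 <= phi i w) ->
  (forall t i w, phi i (relabel t w) = phi (t i) w) ->
  (n%:R%:E * \int[Q]_w ((hit k i0 w)%:R * phi i0 w)%:E =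
   \int[Q]_w (\sum_(i < n) (hit k i w)%:R * phi i w)%:E)%E.
Proof.
move=> mphi phi0 phit.
have mhp i : measurable_fun setT (fun w => (hit k i w)%:R * phi i w).
  apply: measurable_funM => //; apply: measurable_bool_natr.
  exact: measurable_hit.
have hp0 i w : 0 <= (hit k i w)%:R * phi i w by rewrite mulr_ge0.
have E i : (\int[Q]_w ((hit k i w)%:R * phi i w)%:E =
    \int[Q]_w ((hit k i0 w)%:R * phi i0 w)%:E)%E.
  rewrite -[RHS](integral_preserving (measurable_relabel (tperm i0 i))
     (@relabel_preserving (tperm i0 i))).
  - by apply: eq_integral => w _; rewrite hit_relabel phit tpermL.
  - exact/measurable_EFinP.
  - by move=> w; rewrite lee_fin.
under [RHS]eq_integral do rewrite -sumEFin.
rewrite ge0_integral_sum//; last 2 first.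
- by move=> i; exact/measurable_EFinP.
- by move=> i w _; rewrite lee_fin.
under eq_bigr do rewrite E.
by rewrite sumr_const card_ord; exact: mule_natl.
Qed.

End exchangeability.

(** * Expectations over a cycle and almost sure cycle averages *)

Section cycles.
Context (R : realType) (n k : nat).
Local Notation W := (path R (block_index (node_index n))).
Hypothesis kn : (0 < k <= n)%N.
Variable Q : probability W R.
Variable nu : node_index n -> set R -> \bar R.
Hypothesis Q_cylinder : forall s A, uniq s -> (forall j, measurable (A j)) ->
  Q (cylinder s A) = (\prod_(j <- s) nu j.2 (A j))%E.
Hypothesis nu_delay : forall i i' A, measurable A -> nu (inl i) A = nu (inl i') A.
Hypothesis nu_tie : forall (t : {perm 'I_n}) (A : set R), measurable A ->
  nu (inr true) [set y | A (tie_code R (t * tie_decode n y)%g)] = nu (inr true) A.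
Hypothesis gap2 : (\int[Q]_w (gap w 0 ^+ 2)%:E < +oo)%E.
Hypothesis delay2 : forall i, (\int[Q]_w (delay w 0 i ^+ 2)%:E < +oo)%E.
Variable i0 : 'I_n.

Local Notation theta := (next_cycle k).
Local Notation Y := (cycle_time k).
Local Notation B w := ((hit k i0 w)%:R : R).
Local Notation D w := (delay w 0 i0).

Let Q1 : Q [set: W] = 1%E. Proof. exact: probability_setT. Qed.
Let mtheta : measurable_fun setT (theta : W -> W). Proof. exact: measurable_next_cycle. Qed.
Let mY : measurable_fun setT (Y : W -> R). Proof. exact: measurable_cycle_time. Qed.
Let mB : measurable_fun setT (fun w : W => B w).
Proof. by apply: measurable_bool_natr; exact: measurable_hit. Qed.
Let mD : measurable_fun setT (fun w : W => D w). Proof. exact: measurable_delay. Qed.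
Let B01 (w : W) : 0 <= B w <= 1. Proof. by case: (hit _ _ _); rewrite ?lexx ?ler01. Qed.
Let stop_ae' : {ae Q, forall w, exists m, stop k m w}.
Proof. exact: (stop_ae kn Q_cylinder delay2). Qed.

Lemma cycle_preserving C : measurable C -> Q (theta @^-1` C) = Q C.
Proof.
apply: (stop_preserving Q_cylinder (stop := stop k)) => //.
- by move=> m; exact: measurable_stop.
- exact: stop_trivIset.
- exact: stop_agree.
- exact: next_cycleE.
Qed.

Lemma cycle_ergodic I : measurable I -> theta @^-1` I = I ->
  Q I = 0%E \/ Q I = 1%E.
Proof.
apply: (stop_ergodic Q_cylinder (stop := stop k)) => //.
- by move=> m; exact: measurable_stop.
- exact: stop0.
- exact: stop_trivIset.
- exact: stop_agree.
- exact: next_cycleE.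
Qed.

Lemma cycle_markov (f g : W -> R) (c : R) : measurable_fun setT f ->
  (forall w, 0 <= f w) -> measurable_fun setT g -> (forall w, 0 <= g w) ->
  (forall m w w', agree m w w' -> stop k m w -> f w = f w') ->
  (\int[Q]_w (g w)%:E = c%:E)%E ->
  (\int[Q]_w (f w * g (theta w))%:E = (\int[Q]_w (f w)%:E) * c%:E)%E.
Proof.
move=> mf f0 mg g0 fa gc; under eq_integral do rewrite EFinM.
have H := strong_markov Q_cylinder (fun m => measurable_stop kn m)
  (stop_trivIset kn) stop_ae' (stop_agree kn) mtheta (next_cycleE kn).
apply: (H (EFin \o f) (EFin \o g)) => //.
- exact/measurable_EFinP.
- exact/measurable_EFinP.
- by move=> m w w' ww mw /=; rewrite (fa _ _ _ ww mw).
Qed.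

(* The delay until node i0 next receives an update, counted from the start of
   the service of update 0 and truncated to the first j services. *)
Fixpoint receipt_upto (j : nat) (w : W) : R :=
  if j is j'.+1 then B w * D w + (1 - B w) * (Y w + receipt_upto j' (theta w))
  else 0.

Lemma receipt_upto_ge0 j w : 0 <= receipt_upto j w.
Proof.
elim: j w => //= j IH w; have /andP[b0 b1] := B01 w.
apply: addr_ge0; apply: mulr_ge0 => //; [exact/ltW/delay_gt0|by rewrite subr_ge0|].
by apply: addr_ge0 => //; exact: cycle_time_ge0.
Qed.

Lemma receipt_uptoS j w : receipt_upto j w <= receipt_upto j.+1 w.
Proof.
elim: j w => [|j IH] w; first exact: receipt_upto_ge0.
rewrite /= lerD2l ler_wpM2l ?subr_ge0 ?lerD2l//.
by case/andP: (B01 w).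
Qed.

Lemma measurable_receipt_upto j : measurable_fun setT (receipt_upto j).
Proof.
elim: j => //= j IH; apply: measurable_funD; first exact: measurable_funM.
apply: measurable_funM; first exact: measurable_funB.
by apply: measurable_funD => //; exact: (measurableT_comp IH mtheta).
Qed.

Let n0 : (0 < n)%N. Proof. by case/andP: kn => k0; exact: leq_trans. Qed.
Let nR : n%:R != 0 :> R. Proof. by rewrite pnatr_eq0 -lt0n. Qed.
Definition hit_prob : R := k%:R / n%:R.
Definition mean_cycle : R := \int[Q]_w Y w.
Definition mean_hit_delay : R := n%:R^-1 * \int[Q]_w \sum_(1 <= j < k.+1) order_stat (delay w 0) j.
(** The solution h of [h = mean_hit_delay + (1 - hit_prob) * (mean_cycle + h)], the recursion of
    [receipt_upto] in expectation. *)
Definition mean_receipt : R :=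
  (mean_hit_delay + (1 - hit_prob) * mean_cycle) / hit_prob.

Lemma hit_prob_gt0 : 0 < hit_prob.
Proof. by rewrite divr_gt0 ?ltr0n//; case/andP: kn. Qed.

Lemma hit_prob_le1 : hit_prob <= 1.
Proof. by rewrite ler_pdivrMr ?ltr0n// mul1r ler_nat; case/andP: kn. Qed.

Lemma integral_cycle_time : (\int[Q]_w (Y w)%:E = mean_cycle%:E)%E.
Proof.
rewrite fineK// ge0_fin_numE; first exact: (cycle_time1 kn Q_cylinder).
by apply: integral_ge0 => w _; rewrite lee_fin cycle_time_ge0.
Qed.

Lemma integral_hit_cycle :
  (\int[Q]_w (B w * Y w)%:E = (hit_prob * mean_cycle)%:E)%E.
Proof.
have := hit_integral k Q_cylinder nu_delay nu_tie (phi := fun=> Y) i0.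
move=> /(_ (fun=> mY) (fun i w => cycle_time_ge0 k w)).
move=> /(_ (fun t i w => cycle_time_relabel kn t w)).
under [in X in _ = X -> _]eq_integral => w _.
  rewrite -mulr_suml card_among_earliest; last by case/andP: kn.
  rewrite EFinM; over.
rewrite ge0_integralZl_EFin//; first last.
- exact/measurable_EFinP.
- by move=> w _; rewrite lee_fin cycle_time_ge0.
rewrite integral_cycle_time => E.
rewrite /hit_prob [in RHS]mulrAC [in RHS]mulrC EFinM EFinM -E.
by rewrite muleA -EFinM mulVf// mul1e.
Qed.

Lemma integral_hit : (\int[Q]_w (B w)%:E = hit_prob%:E)%E.
Proof.
have := hit_integral k Q_cylinder nu_delay nu_tie (phi := fun _ _ => 1) i0.
move=> /(_ (fun=> measurable_cst _) (fun i w => ler01)).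
move=> /(_ (fun t i w => erefl)).
under [in X in X = _ -> _]eq_integral do rewrite mulr1.
under [in X in _ = X -> _]eq_integral => w _.
  rewrite -mulr_suml card_among_earliest; last by case/andP: kn.
  rewrite mulr1; over.
rewrite [X in _ = X -> _](_ : _ = k%:R%:E); last first.
  by rewrite integral_cst// [X in (_ * X)%E]Q1 mule1.
move=> E.
rewrite /hit_prob [in RHS]mulrC EFinM -E.
by rewrite muleA -EFinM mulVf// mul1e.
Qed.

Lemma order_stat_integrable j : (0 < j <= n)%N ->
  Q.-integrable setT (fun w => (order_stat (delay w 0) j)%:E).
Proof.
move=> jn; apply: ge0_integrable_ltoo.
- by apply: measurable_order_stat => // i; exact: measurable_delay.
- by move=> w; rewrite ltW//; apply: order_stat_gt0 => // i; exact: delay_gt0.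
- exact: (@service1 R n j jn Q).
Qed.

Lemma sum_order_stat_fin_num :
  (\int[Q]_w (\sum_(1 <= j < k.+1) order_stat (delay w 0) j)%:E)%E \is a fin_num.
Proof.
under eq_integral do rewrite -sumEFin big_nat_cond.
apply: integrable_fin_num => //; apply: integrable_sum => // j.
rewrite andbT => /andP[j1 jk]; apply: order_stat_integrable.
by rewrite j1 (leq_trans (jk : (j <= k)%N))//; case/andP: kn.
Qed.

Lemma integral_sum_order_stat :
  (\sum_(1 <= j < k.+1) \int[Q]_w (order_stat (delay w 0) j)%:E =
   (n%:R * mean_hit_delay)%:E)%E.
Proof.
(* Setting the terms outside the range to zero makes every [F j] integrable, as [integral_sum] asks
   of all indices. *)
pose F j (w : W) := if (0 < j <= n)%N then order_stat (delay w 0) j else 0.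
have FE j w : (0 < j < k.+1)%N -> F j w = order_stat (delay w 0) j.
  move=> /andP[j0 jk]; rewrite /F j0 (leq_trans (jk : (j <= k)%N))//.
  by case/andP: kn.
transitivity (\sum_(1 <= j < k.+1) \int[Q]_w (F j w)%:E)%E.
  by apply: eq_big_nat => j jk; apply: eq_integral => w _; rewrite FE.
rewrite -integral_sum//; last first.
  move=> j; rewrite /F; case: (boolP (0 < j <= n)%N) => jn; first exact: order_stat_integrable.
  exact: integrable0.
rewrite /mean_hit_delay mulVKf// fineK ?sum_order_stat_fin_num//.
apply: eq_integral => w _; rewrite sumEFin; congr EFin.
by apply: eq_big_nat => j jk; rewrite FE.
Qed.

Lemma integral_hit_delay : (\int[Q]_w (B w * D w)%:E = mean_hit_delay%:E)%E.
Proof.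
have := hit_integral k Q_cylinder nu_delay nu_tie
  (phi := fun i w => delay w 0 i) i0.
move=> /(_ (fun i => measurable_delay _ _) (fun i w => ltW (delay_gt0 w _ i))).
move=> /(_ (fun t i w => delay_relabel t w i)).
under [in X in _ = X -> _]eq_integral => w _.
  rewrite sum_among_earliest; last by case/andP: kn.
  over.
move=> E; rewrite /mean_hit_delay /Rintegral EFinM fineK; last exact: sum_order_stat_fin_num.
by rewrite -E muleA -EFinM mulVf// mul1e.
Qed.

Lemma mean_cycle_ge0 : 0 <= mean_cycle.
Proof.
by rewrite -lee_fin -integral_cycle_time; apply: integral_ge0 => w _;
  rewrite lee_fin cycle_time_ge0.
Qed.

(** The factor [1 - B] is known within the current cycle, so the strong Markov property separates it
    from the later wait. The expectations thus satisfy [e (j+1) = p h + (1 - p) e j], with p the hit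
    probability and h the fixed point [mean_receipt]. *)
Lemma integral_receipt_upto j : (\int[Q]_w (receipt_upto j w)%:E =
  (mean_receipt - (1 - hit_prob) ^+ j * mean_receipt)%:E)%E.
Proof.
have C1 (w : W) : 0 <= 1 - B w by rewrite subr_ge0; case/andP: (B01 w).
have mC : measurable_fun setT (fun w : W => 1 - B w) by exact: measurable_funB.
elim: j => [|j IH]; first by rewrite integral0 expr0 mul1r subrr.
have intC (f : W -> R) (a b : R) : measurable_fun setT f -> (forall w, 0 <= f w) ->
    (\int[Q]_w (B w * f w)%:E = a%:E)%E -> (\int[Q]_w (f w)%:E = b%:E)%E ->
    (\int[Q]_w ((1 - B w) * f w)%:E = (b - a)%:E)%E.
  move=> mf f0 fa fb.
  have bE : (b%:E = a%:E + \int[Q]_w ((1 - B w) * f w)%:E)%E.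
    rewrite -fb -fa -ge0_integralD//; first last.
    - by apply/measurable_EFinP; exact: measurable_funM.
    - by move=> w _; rewrite lee_fin mulr_ge0.
    - by apply/measurable_EFinP; exact: measurable_funM.
    - by move=> w _; rewrite lee_fin mulr_ge0.
    by apply: eq_integral => w _; rewrite -EFinD -mulrDl subrKC mul1r.
  by rewrite EFinB bE addeAC subee// add0e.
have E1 : (\int[Q]_w ((1 - B w) * Y w)%:E = ((1 - hit_prob) * mean_cycle)%:E)%E.
  rewrite (intC Y (hit_prob * mean_cycle) mean_cycle)//.
  - by rewrite mulrBl mul1r.
  - exact: cycle_time_ge0.
  - exact: integral_hit_cycle.
  - exact: integral_cycle_time.
have E0 : (\int[Q]_w (1 - B w)%:E = (1 - hit_prob)%:E)%E.
  have := intC (fun=> 1) hit_prob 1.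
  under [in X in (_ -> _ -> X -> _)]eq_integral do rewrite mulr1.
  under [in X in (_ -> _ -> _ -> _ -> X)]eq_integral do rewrite mulr1.
  apply => //; first exact: integral_hit.
  by rewrite integral_cst// [X in (_ * X)%E]Q1 mule1.
have E2 : (\int[Q]_w ((1 - B w) * receipt_upto j (theta w))%:E =
   ((1 - hit_prob) * (mean_receipt - (1 - hit_prob) ^+ j * mean_receipt))%:E)%E.
  rewrite (cycle_markov (f := fun w => 1 - B w) (g := receipt_upto j) _ _ _ _ _ IH)//.
  - by rewrite E0.
  - exact: measurable_receipt_upto.
  - exact: receipt_upto_ge0.
  - by move=> m w w' ww mw; rewrite (agree_hit _ _ (stop_gt0 kn mw) ww).
under eq_integral => w _.
  rewrite /= mulrDr addrA 2!EFinD; over.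
have mr : measurable_fun setT (fun w : W => receipt_upto j (theta w)).
  exact: (measurableT_comp (measurable_receipt_upto j) mtheta).
have p1 (w : W) : (0 <= (B w * D w)%:E)%E by rewrite lee_fin mulr_ge0// ltW// delay_gt0.
have p2 (w : W) : (0 <= ((1 - B w) * Y w)%:E)%E by rewrite lee_fin mulr_ge0// cycle_time_ge0.
have p3 (w : W) : (0 <= ((1 - B w) * receipt_upto j (theta w))%:E)%E.
  by rewrite lee_fin mulr_ge0// receipt_upto_ge0.
have q1 : measurable_fun setT (fun w : W => (B w * D w)%:E).
  by apply/measurable_EFinP; exact: measurable_funM.
have q2 : measurable_fun setT (fun w : W => ((1 - B w) * Y w)%:E).
  by apply/measurable_EFinP; exact: measurable_funM.
rewrite ge0_integralD//; first last.
- by apply/measurable_EFinP; exact: measurable_funM.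
- exact: emeasurable_funD.
- by move=> w _; rewrite adde_ge0.
rewrite ge0_integralD// integral_hit_delay E1 E2 -!EFinD; congr EFin.
have p0 : hit_prob != 0 by rewrite gt_eqF// hit_prob_gt0.
have -> : mean_hit_delay + (1 - hit_prob) * mean_cycle = hit_prob * mean_receipt.
  by rewrite /mean_receipt [RHS]mulrC divfK.
by rewrite exprS; ring.
Qed.

(** In the extended reals the monotone limit exists on every path, and monotone convergence applies
    without an exceptional set. *)
Definition receipt_ext (w : W) : \bar R := limn (fun j => (receipt_upto j w)%:E).
(* fine maps +oo to 0; almost surely the limit is finite. *)
Definition receipt (w : W) : R := fine (receipt_ext w).

Lemma receipt_upto_le w : {homo (fun j => (receipt_upto j w)%:E) : i j / (i <= j)%N >-> (i <= j)%E}.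
Proof.
move=> i j ij; rewrite lee_fin.
by move: i j ij; apply/nondecreasing_seqP => j; exact: receipt_uptoS.
Qed.

Lemma receipt_ext_cvg w : (receipt_upto j w)%:E @[j --> \oo] --> receipt_ext w.
Proof. by apply: ereal_nondecreasing_is_cvgn; exact: receipt_upto_le. Qed.

Lemma receipt_ext_ge j w : ((receipt_upto j w)%:E <= receipt_ext w)%E.
Proof.
apply: lime_ge; first by apply/cvg_ex; exists (receipt_ext w); exact: receipt_ext_cvg.
by exists j => // i /= ji; exact: receipt_upto_le.
Qed.

Lemma receipt_ext_ge0 w : (0 <= receipt_ext w)%E.
Proof. by apply: le_trans (receipt_ext_ge 0 w). Qed.

Lemma measurable_receipt_ext : measurable_fun setT receipt_ext.
Proof.
apply: (emeasurable_fun_cvg (fun j => EFin \o receipt_upto j)).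
  by move=> j; apply/measurable_EFinP; exact: measurable_receipt_upto.
by move=> w _; exact: receipt_ext_cvg.
Qed.

Lemma integral_receipt_ext : (\int[Q]_w receipt_ext w = mean_receipt%:E)%E.
Proof.
rewrite monotone_convergence//; last 3 first.
- by move=> j; apply/measurable_EFinP; exact: measurable_receipt_upto.
- by move=> j w _; rewrite lee_fin receipt_upto_ge0.
- by move=> w _; exact: receipt_upto_le.
apply/cvg_lim => //.
under eq_fun do rewrite integral_receipt_upto.
apply: cvg_EFin; first exact: nearW.
rewrite -[X in _ --> X]subr0; apply: cvgB; first exact: cvg_cst.
rewrite -[X in _ --> X](mul0r mean_receipt); apply: cvgM; last exact: cvg_cst.
apply: cvg_expr; rewrite ger0_norm ?subr_ge0 ?hit_prob_le1//.
by rewrite ltrBlDr ltrDl hit_prob_gt0.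
Qed.

Lemma receipt_ae : {ae Q, forall w, receipt_ext w = (receipt w)%:E}.
Proof.
have i : Q.-integrable setT receipt_ext.
  apply/integrableP; split; first exact: measurable_receipt_ext.
  under eq_integral do rewrite gee0_abs ?receipt_ext_ge0//.
  by rewrite integral_receipt_ext ltry.
by apply: filterS (integrable_ae measurableT i) => w /(_ Logic.I) /fineK.
Qed.

Lemma measurable_receipt : measurable_fun setT receipt.
Proof. exact: (measurableT_comp _ measurable_receipt_ext). Qed.

Lemma receipt_ge0 w : 0 <= receipt w.
Proof. exact/fine_ge0/receipt_ext_ge0. Qed.

Lemma integral_receipt : (\int[Q]_w (receipt w)%:E = mean_receipt%:E)%E.
Proof.
rewrite -integral_receipt_ext; apply: ae_eq_integral => //.
- by apply/measurable_EFinP; exact: measurable_receipt.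
- exact: measurable_receipt_ext.
- by apply: filterS receipt_ae => w -> _.
Qed.

(** The limit of the recursion of [receipt_upto]. Finiteness is assumed because [fine] would turn an
    infinite limit into 0. *)
Lemma receipt_rec w : receipt_ext w = (receipt w)%:E ->
  receipt_ext (theta w) = (receipt (theta w))%:E ->
  receipt w = B w * D w + (1 - B w) * (Y w + receipt (theta w)).
Proof.
move=> fw ftw; apply: EFin_inj; rewrite -fw.
have H : (receipt_upto j (theta w)) @[j --> \oo] --> receipt (theta w).
  have := @receipt_ext_cvg (theta w); rewrite ftw.
  by move/fine_cvgP => [_].
apply/cvg_lim => //; rewrite -(cvg_shiftS (fun j => (receipt_upto j w)%:E)) /=.
apply: cvg_EFin; first exact: nearW.
apply: cvgD; first exact: cvg_cst.
by apply: cvgM; [exact: cvg_cst|apply: cvgD => //; exact: cvg_cst].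
Qed.

Lemma mean_cycle_gt0 : 0 < mean_cycle.
Proof.
rewrite lt_neqAle mean_cycle_ge0 andbT eq_sym; apply/eqP => y0.
have : (\int[Q]_w `|(Y w)%:E| = 0)%E.
  under eq_integral do rewrite gee0_abs ?lee_fin ?cycle_time_ge0//.
  by rewrite integral_cycle_time y0.
move/ae_eq_integral_abs => /(_ measurableT)[]; first exact/measurable_EFinP.
move=> N1 [mN1 N10 sub1]; have [N2 [mN2 N20 sub2]] := stop_ae'.
have : Q setT = 0%E.
  apply/eqP; rewrite -measure_le0 -(null_set_setU mN1 mN2 N10 N20).
  apply: le_measure; rewrite ?inE//; first exact: measurableU.
  move=> w _; apply/not_notP => /not_orP[w1 w2].
  have : ~ (~ exists m, stop k m w) by move=> h; apply: w2; exact: sub2.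
  move=> /contrapT[m mw]; apply: w1; apply: sub1 => /= /(_ Logic.I)[].
  rewrite (cycle_timeE kn mw); move: mw => /andP[_ mw] e.
  by move: mw; rewrite e ltNge ltW// service_gt0.
by rewrite [X in X = _ -> _]Q1 => /eqP; rewrite onee_eq0.
Qed.

Definition area (w : W) : R := Y w ^+ 2 / 2 + Y w * receipt (theta w).
Definition mean_area : R := (\int[Q]_w (Y w ^+ 2)) / 2 + mean_cycle * mean_receipt.

Lemma integral_area : (\int[Q]_w (area w)%:E = mean_area%:E)%E.
Proof.
have mY2 : measurable_fun setT (fun w : W => Y w ^+ 2) by exact: measurable_funX.
have mrt : measurable_fun setT (receipt \o theta).
  exact: (measurableT_comp measurable_receipt mtheta).
under eq_integral do rewrite /area EFinD.
rewrite ge0_integralD//; first last.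
- by apply/measurable_EFinP; exact: measurable_funM.
- by move=> w _; rewrite lee_fin mulr_ge0 ?cycle_time_ge0 ?receipt_ge0.
- by apply/measurable_EFinP; exact: measurable_funM.
- by move=> w _; rewrite lee_fin mulr_ge0// sqr_ge0.
rewrite (cycle_markov (f := Y) (g := receipt) _ _ _ _ _ integral_receipt)//; last 4 first.
- exact: cycle_time_ge0.
- exact: measurable_receipt.
- exact: receipt_ge0.
- by move=> m w w'; exact: agree_cycle_time.
rewrite integral_cycle_time /mean_area EFinD EFinM; congr (_ + _)%E.
rewrite /Rintegral EFinM fineK; last first.
  rewrite ge0_fin_numE; first exact: (cycle_time2 kn Q_cylinder).
  by apply: integral_ge0 => w _; rewrite lee_fin sqr_ge0.
under eq_integral do rewrite EFinM.
rewrite ge0_integralZr//.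
- exact/measurable_EFinP.
- by move=> w _; rewrite lee_fin sqr_ge0.
Qed.

Lemma integrable_of_integral (f : W -> R) (c : R) : measurable_fun setT f ->
  (forall w, 0 <= f w) -> (\int[Q]_w (f w)%:E = c%:E)%E ->
  Q.-integrable setT (EFin \o f).
Proof.
move=> mf f0 fc; apply: ge0_integrable_ltoo => //.
by rewrite fc ltry.
Qed.

Lemma cycle_average (f : W -> R) (c : R) : measurable_fun setT f ->
  (forall w, 0 <= f w) -> (\int[Q]_w (f w)%:E = c%:E)%E ->
  {ae Q, forall w, (m%:R^-1 * \sum_(0 <= j < m) f (iter j theta w))
    @[m --> \oo] --> c}.
Proof.
move=> mf f0 fc.
have := birkhoff mtheta cycle_preserving cycle_ergodic (integrable_of_integral mf f0 fc).
by rewrite /Rintegral fc.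
Qed.

(** The almost sure facts, at all cycle starts, on which the deterministic analysis of a path
    relies. *)
Definition good_path (w : W) : Prop :=
  [/\ forall j, exists m, stop k m (iter j theta w),
      forall j, receipt (iter j theta w) =
        B (iter j theta w) * D (iter j theta w) +
        (1 - B (iter j theta w)) *
          (Y (iter j theta w) + receipt (iter j.+1 theta w)),
      forall i j, receipt_upto i (iter j theta w) <= receipt (iter j theta w),
      forall j, receipt_upto i (iter j theta w) @[i --> \oo] --> receipt (iter j theta w) &
  [/\ (m%:R^-1 * \sum_(0 <= j < m) Y (iter j theta w)) @[m --> \oo] --> mean_cycle,
      (m%:R^-1 * \sum_(0 <= j < m) receipt (iter j theta w)) @[m --> \oo] --> mean_receipt &
      (m%:R^-1 * \sum_(0 <= j < m) area (iter j theta w)) @[m --> \oo] --> mean_area]].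

Lemma good_path_ae : {ae Q, forall w, good_path w}.
Proof.
have marea : measurable_fun setT area.
  apply: measurable_funD; first by apply: measurable_funM => //; exact: measurable_funX.
  by apply: measurable_funM => //; exact: (measurableT_comp measurable_receipt mtheta).
have area0 w : 0 <= area w.
  by rewrite addr_ge0 ?divr_ge0 ?sqr_ge0 ?mulr_ge0 ?cycle_time_ge0 ?receipt_ge0.
have a1 := ae_iter_preserving mtheta cycle_preserving stop_ae'.
have a2 := ae_iter_preserving mtheta cycle_preserving receipt_ae.
have a3 := cycle_average mY (@cycle_time_ge0 _ _ _) integral_cycle_time.
have a4 := cycle_average measurable_receipt receipt_ge0 integral_receipt.
have a5 := cycle_average marea area0 integral_area.
have aI (A C : W -> Prop) : {ae Q, forall w, A w} -> {ae Q, forall w, C w} ->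
    {ae Q, forall w, A w /\ C w}.
  by apply: filterS2 => w.
apply: filterS (aI _ _ (aI _ _ a1 a2) (aI _ _ a3 (aI _ _ a4 a5))).
move=> w [[b1 b2] [b3 [b4 b5]]]; split => //.
- by move=> j; apply: receipt_rec; [exact: b2|rewrite -iterS; exact: b2].
- by move=> i j; rewrite -lee_fin -b2; exact: receipt_ext_ge.
- move=> j; have := @receipt_ext_cvg (iter j theta w); rewrite b2.
  by move/fine_cvgP => [_].
Qed.

End cycles.

(** * The age along a sample path *)

Section renewal_averages.
Context (R : realType).

Lemma invr_cvg_pinfty : (t : R)^-1 @[t --> +oo] --> 0.
Proof.
apply/(@gtr0_cvgV0 _ _ _ _ (fun t : R => t)) => //.
by apply: nbhs_pinfty_gt; exact: num_real.
Qed.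

Lemma truncn_cvg_pinfty (z : R) : 0 < z ->
  Num.truncn (t / z) @[t --> +oo] --> \oo.
Proof.
move=> z0 A [N _ NA]; rewrite nbhs_simpl/=.
exists (N.+1%:R * z); split; first exact: num_real.
move=> t tN; apply: NA => /=; rewrite -ltnS -(ltr_nat R).
have h : N.+1%:R < t / z by rewrite ltr_pdivlMr.
apply: (lt_trans (lt_le_trans _ (ltW h))); last exact: truncnS_gt.
by rewrite ltr_nat.
Qed.

Lemma truncn_ratio_cvg (z : R) : 0 < z ->
  t^-1 * (Num.truncn (t / z))%:R @[t --> +oo] --> z^-1.
Proof.
move=> z0; apply/cvgrPdist_le => e e0.
near=> t.
have t0 : 0 < t by near: t; exact: nbhs_pinfty_gt.
have te : t^-1 <= e.
  by apply: ltW; near: t; move/cvgr_lt : invr_cvg_pinfty; apply.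
have tz : 0 <= t / z by rewrite divr_ge0// ltW.
have h1 : (Num.truncn (t / z))%:R <= t / z by rewrite truncn_le.
have h2 : t / z < (Num.truncn (t / z))%:R + 1.
  by rewrite natr1 truncnS_gt.
have zE : z^-1 = t^-1 * (t / z) by rewrite mulrA mulVf ?mul1r// gt_eqF.
rewrite {1}zE.
rewrite -mulrBr normrM ger0_norm ?invr_ge0 ?(ltW t0)//.
rewrite ger0_norm ?subr_ge0//.
apply: le_trans te; rewrite ler_piMr ?invr_ge0 ?(ltW t0)//.
by move: (Num.truncn _)%:R h1 h2 => *; lra.
Unshelve. all: by end_near. Qed.

(** The index [truncn (t / z)] grows like [t / z]; the offset i is used with 0 to round down and
    with 1 to round up. *)
Lemma average_at_time (s : nat -> R) (g z : R) (i : nat) : 0 < z ->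
  m%:R^-1 * s m @[m --> \oo] --> g ->
  t^-1 * s (Num.truncn (t / z) + i)%N @[t --> +oo] --> g / z.
Proof.
move=> z0 sg.
have jy : (Num.truncn (t / z) + i)%N @[t --> +oo] --> \oo.
  apply: (@cvg_comp _ _ _ (fun t : R => Num.truncn (t / z)) (fun m => (m + i)%N) _ \oo).
    exact: truncn_cvg_pinfty.
  exact: cvg_addnr.
have c1 := cvg_comp _ _ jy sg.
have c2 : t^-1 * (Num.truncn (t / z) + i)%:R @[t --> +oo] --> z^-1.
  under eq_fun do rewrite natrD mulrDr.
  have c3 : t^-1 * (i%:R : R) @[t --> +oo] --> (0 * i%:R : R).
    by apply: cvgM; [exact: invr_cvg_pinfty|exact: cvg_cst].
  have c4 := cvgD (truncn_ratio_cvg z0) c3.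
  rewrite mul0r addr0 in c4; exact: c4.
apply: cvg_trans (cvgM c1 c2); apply: near_eq_cvg.
have j0 : \forall t \near +oo, (0 < Num.truncn (t / z) + i)%N.
  exact: (jy _ (nbhs_infty_gt 0)).
near=> t => /=.
have t0 : (Num.truncn (t / z) + i)%:R != 0 :> R.
  by rewrite pnatr_eq0 -lt0n; near: t; exact: j0.
by move: (s _) (t^-1) t0 => a b; move: (_%:R) => c c0; field.
Unshelve. all: by end_near. Qed.

(* The value v t of an observable at time t is compared with its values s at
   the index truncn (t / z), for z slightly above or below the mean cycle y. *)
Lemma average_squeeze (v : R -> R) (lo up s1 s2 : nat -> R) (y g : R) : 0 < y ->
  m%:R^-1 * lo m @[m --> \oo] --> y -> m%:R^-1 * up m @[m --> \oo] --> y ->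
  m%:R^-1 * s1 m @[m --> \oo] --> g -> m%:R^-1 * s2 m @[m --> \oo] --> g ->
  (forall m t, lo m <= t -> 0 <= t -> s1 m <= v t) ->
  (forall m t, t <= up m -> 0 <= t -> v t <= s2 m) ->
  t^-1 * v t @[t --> +oo] --> g / y.
Proof.
move=> y0 loy upy s1g s2g lov upv; apply/cvgrPdist_le => e e0.
have cont : (g / z) @[z --> y] --> g / y.
  apply: cvgM; first exact: cvg_cst.
  by apply: cvgV => //; rewrite gt_eqF.
have e20 : 0 < e / 2 by rewrite divr_gt0.
move/cvgrPdist_le : cont => /(_ _ e20) [d /= d0 dP].
(* At the index [truncn (t / z1)], with z1 above y, [lo] eventually falls below t; with z2 below y,
   [up] eventually exceeds t. The margin stays within the radius d of continuity and keeps z2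
   positive. *)
pose z1 := y + Num.min d y / 2; pose z2 := y - Num.min d y / 2.
have m0 : 0 < Num.min d y by rewrite lt_min d0.
have md : Num.min d y <= d by rewrite ge_min lexx.
have my : Num.min d y <= y by rewrite ge_min lexx orbT.
have z10 : 0 < z1 by rewrite /z1; lra.
have z20 : 0 < z2 by rewrite /z2; lra.
have b1 : `|g / y - g / z1| <= e / 2.
  apply: dP; rewrite /ball/= /z1 opprD addrA subrr sub0r normrN gtr0_norm ?divr_gt0//.
  lra.
have b2 : `|g / y - g / z2| <= e / 2.
  apply: dP; rewrite /ball/= /z2 opprB addrCA subrr addr0 gtr0_norm ?divr_gt0//.
  lra.
have a1 := average_at_time 0 z10 s1g; have a2 := average_at_time 1 z20 s2g.
have l1 := average_at_time 0 z10 loy; have l2 := average_at_time 1 z20 upy.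
have yz1 : y / z1 < 1 by rewrite ltr_pdivrMr// mul1r /z1; lra.
have yz2 : 1 < y / z2 by rewrite ltr_pdivlMr// mul1r /z2; lra.
near=> t.
have t0 : 0 < t by near: t; exact: nbhs_pinfty_gt.
have L : s1 (Num.truncn (t / z1) + 0)%N <= v t.
  apply: lov; last exact: ltW.
  rewrite -[leRHS]mulr1 -ler_pdivrMl//; apply: ltW.
  near: t; move/cvgr_lt : l1; exact.
have U : v t <= s2 (Num.truncn (t / z2) + 1)%N.
  apply: upv; last exact: ltW.
  rewrite -[leLHS]mulr1 -ler_pdivlMl//; apply: ltW.
  near: t; move/cvgr_gt : l2; exact.
have L' : g / z1 - e / 2 <= t^-1 * v t.
  apply: (@le_trans _ _ (t^-1 * s1 (Num.truncn (t / z1) + 0)%N)); last first.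
    by rewrite ler_pM2l ?invr_gt0.
  apply: ltW; near: t; move/cvgr_gt : a1; apply.
  by rewrite ltrBlDr ltrDl.
have U' : t^-1 * v t <= g / z2 + e / 2.
  apply: (@le_trans _ _ (t^-1 * s2 (Num.truncn (t / z2) + 1)%N)).
    by rewrite ler_pM2l ?invr_gt0.
  apply: ltW; near: t; move/cvgr_lt : a2; apply.
  by rewrite ltrDl.
move: b1 b2; rewrite !ler_norml => /andP[b11 b12] /andP[b21 b22].
by apply/andP; split; lra.
Unshelve. all: by end_near. Qed.

End renewal_averages.

Lemma ltn_mono_of_lt (R : realType) (g : nat -> R) : (forall j, g j < g j.+1) ->
  {mono g : i j / (i < j)%N >-> i < j}.
Proof.
move=> gS; have H : {homo g : i j / (i < j)%N >-> i < j}.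
  move=> i j; elim: j => // j IH; rewrite ltnS leq_eqVlt => /predU1P[->|/IH ij].
    exact: gS.
  exact: lt_trans ij (gS j).
move=> i j; apply/idP/idP => [|/H//].
apply: contraTT; rewrite -leqNgt leq_eqVlt => /predU1P[->|/H/ltW].
  by rewrite ltxx.
by rewrite leNgt.
Qed.

Lemma integral_affine (R : realType) (a d c : R) : a <= d ->
  (\int[lebesgue_measure]_(y in `[a, d[) (y - c)%:E =
   (((d - c) ^+ 2 - (a - c) ^+ 2) / 2)%:E)%E.
Proof.
rewrite le_eqVlt => /predU1P[->|ad].
  by rewrite set_itvco0 integral_set0 subrr mul0r.
pose F (y : R) := 2^-1 * (y - c) ^+ 2.
have dF (y : R) : is_derive y 1 F (y - c).
  rewrite /F; apply: is_derive_eq.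
  by rewrite /GRing.scale/= subr0; field.
have cF (y : R) : {for y, continuous F}.
  by apply: differentiable_continuous; apply/derivable1_diffP.
rewrite integral_itv_bndo_bndc; last first.
  by apply/measurable_EFinP; apply: measurable_funB => //; exact: measurable_id.
rewrite (@continuous_FTC2 _ _ F)//.
- by rewrite -EFinB /F; congr EFin; field.
- apply: continuous_subspaceT => y; apply: cvgB; first exact: cvg_id.
  exact: cvg_cst.
- split => //.
  + by apply: cvg_at_right_filter; exact: cF.
  + by apply: cvg_at_left_filter; exact: cF.
- by move=> y _; rewrite derive1E; exact: derive_val.
Qed.

(** With S the partial sums, [h m / m] is [(1 + 1/m) * S (m+1) / (m+1) - S m / m], and both averages
    tend to l. *)
Lemma average_term (R : realType) (h : nat -> R) (l : R) :
  m%:R^-1 * \sum_(0 <= j < m) h j @[m --> \oo] --> l ->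
  m%:R^-1 * h m @[m --> \oo] --> 0.
Proof.
move=> hl; have hl1 : m.+1%:R^-1 * \sum_(0 <= j < m.+1) h j @[m --> \oo] --> l.
  by rewrite -(cvg_shiftS (fun m => m%:R^-1 * \sum_(0 <= j < m) h j)) in hl.
have inv0 : (m%:R : R)^-1 @[m --> \oo] --> 0.
  apply/gtr0_cvgV0; last exact: cvgr_idn.
  by exists 1%N => // m /= m1; rewrite ltr0n.
have c1 : (1 + m%:R^-1 : R) @[m --> \oo] --> (1 + 0 : R).
  by apply: cvgD => //; exact: cvg_cst.
have l0 : (1 + 0) * l - l = 0 by ring.
rewrite -l0; apply: cvg_trans (cvgB (cvgM c1 hl1) hl); apply: near_eq_cvg.
near=> m => /=.
have m0 : (0 < m)%N by near: m; exact: nbhs_infty_gt.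
have m0' : m%:R != 0 :> R by rewrite pnatr_eq0 -lt0n.
transitivity ((1 + m%:R^-1) * (m.+1%:R^-1 * \sum_(0 <= j < m.+1) h j) -
  m%:R^-1 * \sum_(0 <= j < m) h j); first by [].
rewrite big_nat_recr//=; move: (\sum_(0 <= j < m) _) (h m) => a b.
rewrite -natr1; field.
by rewrite m0' natr1 pnatr_eq0.
Unshelve. all: by end_near. Qed.

(** * Deterministic analysis of one path of the model *)

Section sample_path.
Context (R : realType) (n k : nat) (r : nat -> R) (x : nat -> 'I_n -> R).
Context (s : nat -> {perm 'I_n}) (u0 : R) (i0 : 'I_n).
Hypothesis kn : (0 < k <= n)%N.
Hypothesis u0_le0 : u0 <= 0.
Hypothesis r_gt0 : forall m, 0 < r m.
Hypothesis x_gt0 : forall m i, 0 < x m i.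
(** [M j] is the update that starts service j: update 0 at first, and then always the first arrival
    after the preceding completion. *)
Variable M : nat -> nat.
Hypothesis M0 : M 0%N = 0%N.
Hypothesis MS : forall j, (M j < M j.+1)%N.
Hypothesis M_next : forall j, completion k r x (M j) < arrival r (M j.+1).
Hypothesis M_busy : forall j l, (M j < l < M j.+1)%N ->
  arrival r l <= completion k r x (M j).

Lemma arrivalS m : arrival r m.+1 = arrival r m + r m.+1.
Proof. by rewrite /arrival big_nat_recr. Qed.

Lemma arrival_lt : {mono arrival r : l m / (l < m)%N >-> l < m}.
Proof. by apply: ltn_mono_of_lt => l; rewrite arrivalS ltrDl. Qed.

Lemma arrival_gt0 m : 0 < arrival r m.
Proof.
rewrite /arrival big_nat_recl// ltr_wpDr// sumr_ge0// => j _.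
exact: ltW.
Qed.

Lemma M_mono : {mono M : i j / (i < j)%N}.
Proof.
move=> i j; rewrite -(ltr_nat R) (@ltn_mono_of_lt R (fun j => (M j)%:R))//.
by move=> l; rewrite ltr_nat.
Qed.

Lemma busy_until_cycle j l : (M j < l <= M j.+1)%N ->
  busy_until k r x (M j) < arrival r (M j) ->
  busy_until k r x l = completion k r x (M j).
Proof.
move=> /andP[jl lj] sj; elim: l jl lj => // l IH; rewrite ltnS leq_eqVlt.
move=> /predU1P[<- _|jl lj] /=; first by rewrite sj.
rewrite IH ?(ltnW lj)// ifF//.
by apply/negbTE; rewrite -leNgt; apply: M_busy; rewrite jl.
Qed.

Lemma served_M j : served k r x (M j).
Proof.
elim: j => [|j IH]; rewrite /served; first by rewrite M0 arrival_gt0.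
by rewrite (@busy_until_cycle j)// MS leqnn.
Qed.

Lemma served_exists m : served k r x m -> exists j, m = M j.
Proof.
have [j /andP[jm mj]] : exists j, (M j <= m < M j.+1)%N.
  have ex : exists j, (m < M j)%N.
    exists m.+1; elim: m => [|m IH]; first exact: leq_ltn_trans (MS 0).
    exact: leq_ltn_trans IH (MS _).
  case: (ex_minnP ex) => -[|j]; first by rewrite M0.
  move=> mj minj; exists j; rewrite mj andbT leqNgt; apply/negP => /minj.
  by rewrite ltnn.
move: jm; rewrite leq_eqVlt => /predU1P[<-|jm]; first by exists j.
rewrite /served (@busy_until_cycle j); last exact: served_M.
  by rewrite ltNge M_busy// jm.
by rewrite jm ltnW.
Qed.

Let T j := arrival r (M j).
Let D j := x (M j) i0.
Let b j := among_earliest k (x (M j)) (s (M j)) i0.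
Let Y j := T j.+1 - T j.

Lemma service_start_lt : {mono T : i j / (i < j)%N >-> i < j}.
Proof. by move=> i j; rewrite /T arrival_lt M_mono. Qed.

Lemma hit_delay_lt j : b j -> T j + D j < T j.+1.
Proof.
move=> bj; apply: le_lt_trans (M_next j); rewrite lerD2l.
exact: among_earliest_le bj.
Qed.

(** The stamp held at the start of service j. A hit is delivered before the next service starts, so
    the earlier services determine it. *)
Fixpoint held_stamp (j : nat) : R :=
  if j is j'.+1 then (if b j' then T j' else held_stamp j') else u0.

Lemma held_stamp_le j : held_stamp j <= T j.
Proof.
elim: j => [|j IH] /=; first by rewrite (le_trans u0_le0)// ltW// arrival_gt0.
have : T j < T j.+1 by rewrite service_start_lt.
by case: ifP => _ h; [exact: ltW|exact: le_trans IH (ltW h)].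
Qed.

Lemma held_stamp_ge i j : (i < j)%N -> b i -> T i <= held_stamp j.
Proof.
move=> + bi; elim: j => // j IH; rewrite ltnS leq_eqVlt => /predU1P[<-|ij] /=.
  by rewrite bi.
case: ifP => _; last exact: IH.
by rewrite ltW// service_start_lt.
Qed.

Lemma held_stamp_init j : u0 <= held_stamp j.
Proof.
elim: j => //= j IH; case: ifP => // _.
by rewrite (le_trans u0_le0)// ltW// arrival_gt0.
Qed.

Lemma held_stampP j : held_stamp j = u0 \/
  exists2 i, (i < j)%N & b i /\ held_stamp j = T i.
Proof.
elim: j => [|j IH] /=; first by left.
case: ifP => bj; first by right; exists j.
case: IH => [|[i ij [bi e]]]; first by left.
by right; exists i => //; exact: ltnW.
Qed.

Let u t := last_timestamp k r x s u0 i0 t.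

Lemma last_timestampE t v :
  (v = u0 \/ exists m, received_by k r x s i0 t m /\ v = arrival r m) ->
  u0 <= v -> (forall m, received_by k r x s i0 t m -> arrival r m <= v) ->
  u t = v.
Proof.
move=> vE u0v ubv; rewrite /u /last_timestamp; set E := [set _ | _].
have Ev : E v by exact: vE.
have ub : ubound E v by move=> _ [->|[m [rm ->]]] //; exact: ubv.
apply/eqP; rewrite eq_le; apply/andP; split.
  by apply: ge_sup => //; exists v.
by apply: sup_ubound => //; exists v.
Qed.

Lemma last_timestamp_start t : t < T 0%N -> u t = u0.
Proof.
move=> t0; apply: last_timestampE => //; first by left.
move=> m [/served_exists[j ->] _ h].
have : T 0%N <= T j by rewrite leNgt service_start_lt.
have := x_gt0 (M j) i0; move: h t0; rewrite /T; lra.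
Qed.

(** During cycle j the hits of earlier services have been delivered and later services have not
    started, so only the delivery of service j is in question. *)
Lemma last_timestamp_cycle j t : T j <= t < T j.+1 ->
  u t = if b j && (T j + D j <= t) then T j else held_stamp j.
Proof.
move=> /andP[jt tj].
have recv m : received_by k r x s i0 t m ->
    arrival r m <= held_stamp j \/ [/\ m = M j, b j & T j + D j <= t].
  move=> [/served_exists[i ->] bi h].
  have : (i < j.+1)%N.
    rewrite -service_start_lt; apply: le_lt_trans tj; apply: le_trans h.
    by rewrite lerDl ltW.
  rewrite ltnS leq_eqVlt => /predU1P[e|ij]; first by right; rewrite -e.
  by left; exact: held_stamp_ge.
case: ifP => [/andP[bj jt']|nb].
  apply: last_timestampE.
  - by right; exists (M j); split => //; split => //; exact: served_M.
  - by rewrite (le_trans u0_le0)// ltW// arrival_gt0.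
  - move=> m /recv[h|[-> //]]; exact: le_trans h (held_stamp_le j).
apply: last_timestampE.
- case: (held_stampP j) => [|[i ij [bi e]]]; first by left.
  right; exists (M i); split => //; split => //; first exact: served_M.
  apply: le_trans jt; apply: le_trans (ltW (hit_delay_lt bi)) _.
  by rewrite leNgt service_start_lt -leqNgt.
- exact: held_stamp_init.
- by move=> m /recv[//|[_ bj jt']]; rewrite bj jt' in nb.
Qed.

Let A j := T j - held_stamp j.
Let W j := if b j then D j else Y j.

Lemma held_age_ge0 j : 0 <= A j.
Proof. by rewrite subr_ge0 held_stamp_le. Qed.

Lemma held_ageS j : A j.+1 = Y j + (if b j then 0 else A j).
Proof. by rewrite /A /Y /=; case: ifP => _; lra. Qed.

Let f t := age k r x s u0 i0 t.

(** Measurability, sign and value are kept together so that the integral can be extended piece by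
    piece; half-open intervals make the pieces disjoint. *)
Definition age_integral (t v : R) : Prop :=
  [/\ 0 <= t, measurable_fun `[0%R, t[ f, forall y, 0 <= y < t -> 0 <= f y &
      (\int[lebesgue_measure]_(y in `[0%R, t[) (f y)%:E = v%:E)%E].

Lemma age_integral0 : age_integral 0 0.
Proof.
split => //; first by rewrite set_itvco0; exact: measurable_fun_set0.
- by move=> y /andP[y0 /(le_lt_trans y0)]; rewrite ltxx.
- by rewrite set_itvco0 integral_set0.
Qed.

Lemma age_integral_extend a d c v : age_integral a v -> a <= d -> c <= a ->
  (forall t, a <= t < d -> f t = t - c) ->
  age_integral d (v + ((d - c) ^+ 2 - (a - c) ^+ 2) / 2).
Proof.
move=> [a0 mf f0 fv] ad ca fE.
have U : `[0%R, d[%classic = `[0%R, a[%classic `|` `[a, d[%classic :> set R.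
  by rewrite -itv_bndbnd_setU// bnd_simp.
have mad : measurable_fun `[a, d[ f.
  have H : measurable_fun `[a, d[ (fun t : R => t - c).
    by apply: measurable_funB => //; exact: measurable_id.
  by apply: eq_measurable_fun H => t; rewrite inE/= in_itv/= => /fE ->.
have mU : measurable_fun `[0%R, d[ f by rewrite U; apply/measurable_funU.
have fU t : 0 <= t < d -> 0 <= f t.
  move=> /andP[t0 td]; have [ta|ta] := ltP t a; first by rewrite f0// t0.
  by rewrite fE ?ta// subr_ge0 (le_trans ca).
split => //; first exact: le_trans ad.
rewrite U ge0_integral_setU//.
- rewrite fv EFinD; congr (_ + _)%E.
  rewrite -integral_affine//; apply: eq_integral => t.
  by rewrite inE/= in_itv/= => /fE ->.
- by rewrite -U; exact/measurable_EFinP.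
- by rewrite -U => t /=; rewrite in_itv/= => /fU; rewrite lee_fin.
- rewrite disj_set2E; apply/eqP/seteqP; split => // t [] /=.
  by rewrite !in_itv/= => /andP[_ ta] /andP[/(lt_le_trans ta)]; rewrite ltxx.
Qed.

Lemma age_integral_le a d v v' : age_integral a v -> age_integral d v' ->
  a <= d -> v <= v'.
Proof.
move=> [_ mf f0 fv] [_ mf' f0' fv'] ad; rewrite -lee_fin -fv -fv'.
apply: ge0_subset_integral => //.
- exact/measurable_EFinP.
- by apply: subset_itvl; rewrite bnd_simp.
Qed.

Lemma age_integral_restrict a d v' : age_integral d v' -> 0 <= a <= d ->
  exists v, age_integral a v.
Proof.
move=> [d0 mf' f0' fv'] /andP[a0 ad].
have sub : `[0%R, a[%classic `<=` `[0%R, d[%classic.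
  by apply: subset_itvl; rewrite bnd_simp.
have f0 y : 0 <= y < a -> 0 <= f y.
  by move=> /andP[y0 ya]; apply: f0'; rewrite y0 (lt_le_trans ya).
have mf : measurable_fun `[0%R, a[ f by exact: measurable_funS sub mf'.
exists (fine (\int[lebesgue_measure]_(y in `[0%R, a[) (f y)%:E)%E); split => //.
rewrite fineK// ge0_fin_numE; last first.
  by apply: integral_ge0 => y /=; rewrite in_itv/= lee_fin; exact: f0.
apply: (@le_lt_trans _ _ v'%:E); last exact: ltry.
rewrite -fv'; apply: ge0_subset_integral => //; exact/measurable_EFinP.
Qed.

(* The integral of the age up to the start of service j: T j is the start of
   service j, Y j the length of its cycle, and A j the excess of the age at T j,
   which persists for the time W j. *)
Fixpoint age_sum (j : nat) : R :=
  if j is j'.+1 then age_sum j' + Y j' ^+ 2 / 2 + A j' * W j'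
  else ((T 0%N - u0) ^+ 2 - u0 ^+ 2) / 2.

Let Y_gt0 j : 0 < Y j. Proof. by rewrite subr_gt0 service_start_lt. Qed.
Let D_gt0 j : 0 < D j. Proof. exact: x_gt0. Qed.
Let W_gt0 j : 0 < W j. Proof. by rewrite /W; case: ifP. Qed.

Let W_le j : W j <= Y j.
Proof.
rewrite /W; case: ifP => // /hit_delay_lt; rewrite /Y; lra.
Qed.

Lemma age_integral_wait j v t : age_integral (T j) v -> 0 <= t <= W j ->
  age_integral (T j + t) (v + A j * t + t ^+ 2 / 2).
Proof.
move=> Iv /andP[t0 tW].
have -> : v + A j * t + t ^+ 2 / 2 =
    v + ((T j + t - held_stamp j) ^+ 2 - (T j - held_stamp j) ^+ 2) / 2.
  by rewrite /A; field.
apply: age_integral_extend => //; first by rewrite lerDl.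
  exact: held_stamp_le.
move=> y /andP[Ty yt]; rewrite /f /age; congr (_ - _).
rewrite -/(u y) (@last_timestamp_cycle j).
  case: ifP => // /andP[bj h]; move: tW; rewrite /W bj; lra.
by rewrite Ty/=; have := W_le j; rewrite /Y; lra.
Qed.

(** The old stamp is held for the time [W j]. After a hit, the rest of the cycle is a second piece
    with stamp [T j]; without one, [W j] is the whole cycle. *)
Lemma age_integral_service j : age_integral (T j) (age_sum j).
Proof.
elim: j => [|j IH].
  have := @age_integral_extend 0 (T 0%N) u0 0 age_integral0.
  rewrite add0r sub0r sqrrN; apply => //; first by rewrite ltW// arrival_gt0.
  by move=> t /andP[_ t0]; rewrite /f /age -/(u t) last_timestamp_start.
have IW := age_integral_wait IH (_ : 0 <= W j <= W j).
move: IW; rewrite lexx (ltW (W_gt0 j)) => /(_ isT) IW /=.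
case: (boolP (b j)) => bj; last first.
  have WY : W j = Y j by rewrite /W (negbTE bj).
  have TE : T j.+1 = T j + W j by rewrite WY /Y; lra.
  rewrite TE; congr (age_integral _ _) : IW; rewrite WY; lra.
have WD : W j = D j by rewrite /W bj.
have -> : age_sum j + Y j ^+ 2 / 2 + A j * W j =
    age_sum j + A j * W j + W j ^+ 2 / 2 +
    ((T j.+1 - T j) ^+ 2 - (T j + W j - T j) ^+ 2) / 2.
  by rewrite /Y; field.
apply: age_integral_extend => //.
- by have := W_le j; rewrite /Y; lra.
- by rewrite lerDl ltW.
move=> t /andP[Tt tT]; rewrite /f /age -/(u t) (@last_timestamp_cycle j).
  by rewrite bj -WD Tt.
by rewrite tT andbT (le_trans _ Tt)// lerDl ltW.
Qed.

(** [receipt] and its truncations along the cycles of one path. The recursion of h need not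
    terminate, so the induction runs on the truncations and reaches h in the limit. *)
Variables (h : nat -> R) (hK : nat -> nat -> R).
Let B j : R := (b j)%:R.
Hypothesis h_rec : forall j, h j = B j * D j + (1 - B j) * (Y j + h j.+1).
Hypothesis hK0 : forall j, hK 0 j = 0.
Hypothesis hKS : forall i j, hK i.+1 j = B j * D j + (1 - B j) * (Y j + hK i j.+1).
Hypothesis hK_ge0 : forall i j, 0 <= hK i j.
Hypothesis hK_le : forall i j, hK i j <= h j.
Hypothesis hK_cvg : forall j, hK i j @[i --> \oo] --> h j.

Let h_ge0 j : 0 <= h j. Proof. exact: le_trans (hK_ge0 0 j) (hK_le 0 j). Qed.

Let area j := Y j ^+ 2 / 2 + Y j * h j.+1.
Let c0 := age_sum 0 + A 0 * h 0.

(* A summation by parts: the potential A m * h m counts the excess age accrued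
   before T m that will be observed after it. *)
Lemma age_sumE m : age_sum m + A m * h m = c0 + \sum_(0 <= j < m) area j.
Proof.
elim: m => [|m IH]; first by rewrite big_geq// addr0.
rewrite big_nat_recr//= addrA -IH held_ageS /area /W (h_rec m) /B.
by case: (b m) => /=; rewrite ?mulr1n ?mulr0n; ring.
Qed.

Lemma age_sum_le m : age_sum m <= c0 + \sum_(0 <= j < m) area j.
Proof. by rewrite -age_sumE lerDl mulr_ge0// held_age_ge0. Qed.

(** After a miss, [A j.+1 = Y j + A j]: the excess [A j] persists into the next cycle, and the part
    due to [Y j] only increases the integral. At a hit the wait ends after [D j]. *)
Lemma age_integral_ge_upto i j t v : T j + hK i j <= t -> age_integral t v ->
  age_sum j + A j * hK i j <= v.
Proof.
elim: i j => [|i IH] j.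
  rewrite hK0 mulr0 !addr0 => jt Iv.
  exact: age_integral_le (age_integral_service j) Iv jt.
rewrite hKS /B; case: (boolP (b j)) => bj /=.
  rewrite subrr mul0r addr0 mul1r => jt Iv.
  have := @age_integral_wait j _ (D j) (age_integral_service j).
  rewrite {1}/W bj lexx (ltW (D_gt0 j)) => /(_ isT) Iw.
  apply: le_trans (age_integral_le Iw Iv jt).
  by rewrite lerDl divr_ge0// sqr_ge0.
rewrite mul0r add0r subr0 mul1r => jt Iv.
apply: le_trans (IH j.+1 _ Iv); last by move: jt; rewrite /Y; lra.
rewrite held_ageS (negbTE bj) /= /W (negbTE bj).
have := mulr_ge0 (ltW (Y_gt0 j)) (hK_ge0 i j.+1); have := sqr_ge0 (Y j).
lra.
Qed.

(** Together with [age_sum_le] this encloses the integral: the same sum bounds it from above up to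
    [T j] and from below up to [T j + h j]. *)
Lemma age_integral_ge j t v : T j + h j <= t -> age_integral t v ->
  c0 + \sum_(0 <= j < j) area j <= v.
Proof.
move=> jt Iv; rewrite -age_sumE.
have cv : age_sum j + A j * hK i j @[i --> \oo] --> age_sum j + A j * h j.
  by apply: cvgD; [exact: cvg_cst|apply: cvgM => //; exact: cvg_cst].
rewrite -(cvg_lim _ cv)//; apply: limr_le; first by apply/cvg_ex; eexists; exact: cv.
apply: nearW => i; apply: age_integral_ge_upto Iv.
by apply: le_trans jt; rewrite lerD2l.
Qed.

Lemma service_startE m : T m = T 0%N + \sum_(0 <= j < m) Y j.
Proof.
by rewrite telescope_sumr// addrCA subrr addr0.
Qed.

Theorem time_average_cvg (y hbar g : R) : 0 < y ->
  m%:R^-1 * \sum_(0 <= j < m) Y j @[m --> \oo] --> y ->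
  m%:R^-1 * \sum_(0 <= j < m) h j @[m --> \oo] --> hbar ->
  m%:R^-1 * \sum_(0 <= j < m) area j @[m --> \oo] --> g ->
  time_average (age k r x s u0 i0) tau @[tau --> +oo%R] --> (g / y)%:E.
Proof.
move=> y0 Yy hh ag.
have inv0 : (m%:R : R)^-1 @[m --> \oo] --> 0.
  apply/gtr0_cvgV0; last exact: cvgr_idn.
  by exists 1%N => // m /= m1; rewrite ltr0n.
have addc (c l : R) (z : nat -> R) : m%:R^-1 * z m @[m --> \oo] --> l ->
    m%:R^-1 * (c + z m) @[m --> \oo] --> l.
  move=> zl; under eq_fun do rewrite mulrDr.
  have : m%:R^-1 * c + m%:R^-1 * z m @[m --> \oo] --> 0 * c + l.
    by apply: cvgD => //; apply: cvgM => //; exact: cvg_cst.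
  by rewrite mul0r add0r.
have Ty : m%:R^-1 * T m @[m --> \oo] --> y.
  by under eq_fun do rewrite service_startE; exact: addc.
have Thy : m%:R^-1 * (T m + h m) @[m --> \oo] --> y.
  under eq_fun do rewrite mulrDr.
  have c1 := cvgD Ty (average_term hh).
  by rewrite addr0 in c1; exact: c1.
(* Every time lies before some service start, up to which the age has a finite integral. *)
have T_unbounded t : exists m, t <= T m.
  have yy : y / 2 < y by lra.
  have [N _ NP] : \forall m \near \oo, y / 2 < m%:R^-1 * T m.
    by move/cvgr_gt : Ty; apply.
  have [q qt] := exists_natr_gt (t / (y / 2)).
  exists (maxn q N).+1; have /NP /= : (N <= (maxn q N).+1)%N by rewrite leqW// leq_maxr.
  have m0 : 0 < (maxn q N).+1%:R :> R by [].
  rewrite ltr_pdivlMl// => /ltW; apply: le_trans.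
  rewrite ltr_pdivrMr ?divr_gt0// in qt; apply: (le_trans (ltW qt)).
  by rewrite ler_wpM2r ?divr_ge0 ?(ltW y0)// ler_nat leqW// leq_maxl.
pose v t := fine (\int[lebesgue_measure]_(z in `[0%R, t[) (f z)%:E)%E.
have Iv t : 0 <= t -> age_integral t (v t).
  move=> t0; have [m tm] := T_unbounded t.
  have tT : 0 <= t <= T m by rewrite t0.
  have [w Iw] := age_integral_restrict (age_integral_service m) tT.
  by rewrite /v; case: (Iw) => _ _ _ ->.
have : t^-1 * v t @[t --> +oo] --> g / y.
  apply: (@average_squeeze _ v (fun m => T m + h m) T
    (fun m => c0 + \sum_(0 <= j < m) area j)
    (fun m => c0 + \sum_(0 <= j < m) area j)) => //; [exact: addc|exact: addc| |].
  - by move=> m t mt t0; apply: (age_integral_ge mt); exact: Iv.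
  - move=> m t tm t0; apply: le_trans (age_sum_le m).
    exact: age_integral_le (Iv t t0) (age_integral_service m) tm.
move=> cv; have : (t^-1 * v t)%:E @[t --> +oo] --> (g / y)%:E.
  by apply: cvg_EFin => //; exact: nearW.
apply: cvg_trans; apply: near_eq_cvg; near=> t.
have t0 : 0 <= t by near: t; apply: nbhs_pinfty_ge; exact: num_real.
have [_ mf _ If] := Iv t t0.
(* [time_average] integrates over a closed interval, [age_integral] over a half-open one. *)
rewrite /time_average -integral_itv_bndo_bndc; last exact/measurable_EFinP.
by rewrite -[X in (_ * X)%E]/(\int[lebesgue_measure]_(z in `[0%R, t[) (f z)%:E)%E If.
Unshelve. all: by end_near. Qed.

End sample_path.

(** * The average age *)

Section same_law_integrals.
Context d (T : measurableType d) (R : realType) (P : probability T R).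

Lemma same_law_integral (X Y : {RV P >-> R}) (f : R -> \bar R) : same_law X Y ->
  measurable_fun setT f -> (forall y, 0 <= f y)%E ->
  (\int[P]_w f (X w) = \int[P]_w f (Y w))%E.
Proof.
move=> XY mf f0.
rewrite -[LHS](ge0_integral_distribution X mf f0).
rewrite -[RHS](ge0_integral_distribution Y mf f0).
by apply: eq_measure_integral => A mA _; exact: XY.
Qed.

Lemma same_law_gt0 (X Y : {RV P >-> R}) : same_law X Y ->
  {ae P, forall w, 0 < Y w} -> {ae P, forall w, 0 < X w}.
Proof.
move=> XY [N [mN N0 YN]].
have m0 : measurable [set y : R | ~ 0 < y].
  rewrite [X in measurable X](_ : _ = `]-oo, 0]%classic)//.
  by apply/seteqP; split => y /=; rewrite in_itv/= leNgt => /negP.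
exists (X @^-1` [set y | ~ 0 < y]); split => //.
  by rewrite -[X in measurable X]setTI; exact: (measurable_funP X).
have -> : P (X @^-1` [set y | ~ 0 < y]) = P (Y @^-1` [set y | ~ 0 < y]).
  exact: (XY _ m0).
apply/eqP; rewrite -measure_le0 -N0; apply: le_measure; rewrite ?inE//.
by rewrite -[X in measurable X]setTI; exact: (measurable_funP Y).
Qed.

Lemma pos_square_ltoo (X Y : {RV P >-> R}) : same_law X Y ->
  {ae P, forall w, 0 < Y w} -> (\int[P]_w (Y w ^+ 2)%:E < +oo)%E ->
  (\int[P]_w (pos (X w) ^+ 2)%:E < +oo)%E.
Proof.
move=> XY Y0 Y2; have mp : measurable_fun setT (@pos R) by exact: measurable_pos.
have mp2 : measurable_fun setT (fun y : R => pos y ^+ 2) by exact: measurable_funX.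
rewrite (@same_law_integral _ _ (fun y => (pos y ^+ 2)%:E) XY); first last.
- by move=> y; rewrite lee_fin sqr_ge0.
- exact/measurable_EFinP.
rewrite (ae_eq_integral (fun w => (Y w ^+ 2)%:E))//.
- by apply/measurable_EFinP; exact: (measurableT_comp mp2).
- by apply/measurable_EFinP; exact: measurable_funX.
- by apply: filterS Y0 => w Yw _; rewrite /pos Yw.
Qed.

Lemma uniform_perm_seq n (s : T -> {perm 'I_n}) (l : seq {perm 'I_n}) :
  uniform_perm P s -> uniq l ->
  measurable [set w | s w \in l] /\
  P [set w | s w \in l] = ((size l)%:R * n`!%:R^-1)%:E.
Proof.
move=> us; elim: l => [_|p l IH /= /andP[pl ul]].
  have -> : [set w | s w \in [::]] = set0 by apply/seteqP; split.
  by rewrite measure0 mul0r.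
have [ml Pl] := IH ul; have [mp Pp] := us p.
have -> : [set w | s w \in p :: l] = s @^-1` [set p] `|` [set w | s w \in l].
  apply/seteqP; split => w /=; rewrite inE.
    by move=> /predU1P[]; [left|right].
  by move=> [->|->]; rewrite ?eqxx ?orbT.
split; first exact: measurableU.
rewrite measureU//; last first.
  apply/seteqP; split => // w [/= -> h].
  by rewrite h in pl.
by rewrite -natr1 mulrDl mul1r addrC EFinD; congr (_ + _)%E.
Qed.

Lemma uniform_perm_law n (s : T -> {perm 'I_n}) (B : pred {perm 'I_n}) :
  uniform_perm P s ->
  measurable [set w | B (s w)] /\
  P [set w | B (s w)] = (#|B|%:R * n`!%:R^-1)%:E.
Proof.
move=> us; have := uniform_perm_seq us (enum_uniq B).
rewrite -cardE (_ : [set w | s w \in enum B] = [set w | B (s w)])//.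
by apply/seteqP; split => w /=; rewrite mem_enum.
Qed.

End same_law_integrals.

(** * The model as a random path of blocks *)

Section main.
Context (d : measure_display) (T : measurableType d) (R : realType).
Context (P : probability T R) (n k : nat) (X Rt : {RV P >-> R}).
Context (r : nat -> {RV P >-> R}) (x : nat -> 'I_n -> {RV P >-> R}).
Context (s : nat -> T -> {perm 'I_n}) (i0 : 'I_n) (u0 : R).
Hypothesis kn : (0 < k <= n)%N.
Hypothesis u0_le0 : u0 <= 0.
Hypothesis X_gt0 : {ae P, forall w, 0 < X w}.
Hypothesis Rt_gt0 : {ae P, forall w, 0 < Rt w}.
Hypothesis X2 : (\int[P]_w (X w ^+ 2)%:E < +oo)%E.
Hypothesis Rt2 : (\int[P]_w (Rt w ^+ 2)%:E < +oo)%E.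
Hypothesis r_law : forall m, same_law (r m) Rt.
Hypothesis x_law : forall m i, same_law (x m i) X.
Hypothesis s_law : forall m, uniform_perm P (s m).
Hypothesis indep : mutually_independent P (source_events r x s).
Local Notation W := (path R (block_index (node_index n))).

(** The gap after update m is [r m.+1]. The time [r 0] precedes the first service and belongs to no
    cycle. *)
Definition sample_path (w : T) : W := fun j =>
  match j with
  | (m, inl i) => x m i w
  | (m, inr false) => r m.+1 w
  | (m, inr true) => tie_code R (s m w)
  end.

Lemma measurable_tie_event m (A : set R) : measurable [set w | A (tie_code R (s m w))].
Proof.
have [+ _] := uniform_perm_law [pred p | `[< A (tie_code R p) >]] (s_law m).
congr measurable; apply/seteqP; split => w /=; first by move/asboolP.
by move=> ?; exact/asboolP.
Qed.

Lemma measurable_sample_path : measurable_fun setT sample_path.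
Proof.
apply: measurable_path => -[m [i|[]]] /=; [exact: measurable_funP| |exact: measurable_funP].
by move=> _ A mA; rewrite setTI; exact: measurable_tie_event.
Qed.

HB.instance Definition _ := isMeasurableFun.Build _ _ _ _ sample_path measurable_sample_path.

Let Q : probability W R := distribution P [the {mfun T >-> W} of sample_path].

Definition coordinate_law (kappa : node_index n) (A : set R) : \bar R :=
  match kappa with
  | inl _ => distribution P X A
  | inr false => distribution P Rt A
  | inr true => (#|[pred p : {perm 'I_n} | `[< A (tie_code R p) >]]|%:R * n`!%:R^-1)%:E
  end.

Let nu := coordinate_law.

Lemma sample_cylinder l A : uniq l -> (forall j, measurable (A j)) ->
  Q (cylinder l A) = (\prod_(j <- l) nu j.2 (A j))%E.
Proof.
move=> ul mA.
pose emb (j : block_index (node_index n)) : (nat + nat * 'I_n + nat)%type :=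
  match j with
  | (m, inl i) => inl (inr (m, i))
  | (m, inr false) => inl (inl m.+1)
  | (m, inr true) => inr m
  end.
have emb_inj : injective emb.
  by move=> [m [i|[]]] [m' [i'|[]]] //= [-> // ->].
(* The predecessor undoes the shift by one in [emb]; at [r 0], outside the image of [emb], it gives
   a placeholder. *)
pose A' (j : (nat + nat * 'I_n + nat)%type) : set T :=
  match j with
  | inl (inl m) => r m @^-1` A (m.-1, inr false)
  | inl (inr (m, i)) => x m i @^-1` A (m, inl i)
  | inr m => s m @^-1` [set p | A (m, inr true) (tie_code R p)]
  end.
have A'E j : A' (emb j) = [set w | A j (sample_path w j)].
  by case: j => [m [i|[]]].
have -> : Q (cylinder l A) = P (\bigcap_(j in [set` map emb l]) A' j).
  rewrite /Q /distribution /pushforward; congr (P _).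
  apply/seteqP; split => w.
    by move=> h _ /mapP[j jl ->]; rewrite A'E; exact: h.
  by move=> h j jl; have := h (emb j) (map_f emb jl); rewrite A'E.
rewrite indep ?map_inj_uniq//; last first.
  move=> [[m|[m i]]|m] _ /=.
  - by exists (A (m.-1, inr false)); [exact: mA|rewrite setTI].
  - by exists (A (m, inl i)); [exact: mA|rewrite setTI].
  - by exists [set p | A (m, inr true) (tie_code R p)]; rewrite ?setTI.
rewrite big_map; apply: eq_bigr => -[m [i|[]]] _ /=.
- exact: (x_law _ _ (mA _)).
- have [_ +] := uniform_perm_law
    [pred p | `[< A (m, inr true) (tie_code R p) >]] (s_law m).
  move=> <-; congr (P _); apply/seteqP; split => w /=; last by move/asboolP.
  by move=> ?; exact/asboolP.
- exact: (r_law _ (mA _)).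
Qed.

Lemma law_delay i i' A : measurable A -> nu (inl i) A = nu (inl i') A.
Proof. by []. Qed.

(** Left translation is a bijection of the permutations, so it preserves the uniform law. *)
Lemma law_tie (t : {perm 'I_n}) (A : set R) : measurable A ->
  nu (inr true) [set y | A (tie_code R (t * tie_decode n y)%g)] = nu (inr true) A.
Proof.
move=> _; rewrite /nu /=; congr ((_%:R * _)%:E).
rewrite -!sum1_card [RHS](reindex_inj (mulgI t)).
by apply: eq_bigl => p; rewrite !inE tie_codeK.
Qed.

Lemma ge0_integral_sample (f : W -> R) : measurable_fun setT f ->
  (forall w, 0 <= f w) ->
  (\int[Q]_w (f w)%:E = \int[P]_w (f (sample_path w))%:E)%E.
Proof.
move=> mf f0; rewrite (ge0_integral_distribution _ (f := EFin \o f))//.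
exact/measurable_EFinP.
Qed.

Lemma sample_gap2 : (\int[Q]_w (gap w 0 ^+ 2)%:E < +oo)%E.
Proof.
rewrite ge0_integral_sample; last by move=> w; rewrite sqr_ge0.
  exact: (pos_square_ltoo (r_law 1) Rt_gt0 Rt2).
by apply: measurable_funX; exact: measurable_gap.
Qed.

Lemma sample_delay2 i : (\int[Q]_w (delay w 0 i ^+ 2)%:E < +oo)%E.
Proof.
rewrite ge0_integral_sample; last by move=> w; rewrite sqr_ge0.
  exact: (pos_square_ltoo (x_law 0 i) X_gt0 X2).
by apply: measurable_funX; exact: measurable_delay.
Qed.

Definition good_sample (w : T) : Prop :=
  [/\ forall m, 0 < r m w, forall m i, 0 < x m i w & good_path k Q i0 (sample_path w)].

Lemma ae_sample (A : W -> Prop) : {ae Q, forall w, A w} ->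
  {ae P, forall w, A (sample_path w)}.
Proof.
move=> [N [mN N0 AN]]; exists (sample_path @^-1` N); split => //.
- by rewrite -[X in measurable X]setTI; exact: measurable_sample_path.
- by move=> w /= Aw; apply: AN.
Qed.

Lemma good_sample_ae : {ae P, forall w, good_sample w}.
Proof.
have a1 : {ae P, forall w m, 0 < r m w}.
  by apply: ae_foralln => m; exact: same_law_gt0 (r_law m) Rt_gt0.
have a2 : {ae P, forall w m i, 0 < x m i w}.
  apply: ae_foralln => m; apply: filter_forall => i.
  exact: same_law_gt0 (x_law m i) X_gt0.
have a3 : {ae P, forall w, good_path k Q i0 (sample_path w)}.
  apply: ae_sample; apply: good_path_ae => //.
  - exact: sample_cylinder.
  - exact: law_delay.
  - exact: law_tie.
  - exact: sample_gap2.
  - exact: sample_delay2.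
by apply: filterS3 a1 a2 a3 => w b1 b2 b3; split.
Qed.

Lemma good_sample_pos w : good_sample w ->
  (forall m, gap (sample_path w) m = r m.+1 w) /\
  (forall m, delay (sample_path w) m = fun i => x m i w) /\
  (forall m, tie (sample_path w) m = s m w).
Proof.
move=> [r0 x0 _]; split => [m|]; first by rewrite /gap /pos /= r0.
split => m; last by rewrite /tie /= tie_codeK.
by apply/funext => i; rewrite /delay /pos /= x0.
Qed.

(** The [M] of the pathwise analysis: each cycle consumes as many updates as its length. *)
Definition update_index (w : T) (j : nat) : nat :=
  \sum_(0 <= i < j) cycle_length k (iter i (next_cycle k) (sample_path w)).

Lemma iter_next_cycle w j :
  iter j (next_cycle k) (sample_path w) = shift (update_index w j) (sample_path w).
Proof.
elim: j => [|j IH]; first by rewrite /update_index big_geq// shift0.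
by rewrite iterS {1}/next_cycle {2}IH shift_add /update_index big_nat_recr.
Qed.

Lemma good_sample_elapsed w m l : good_sample w ->
  elapsed l (shift m (sample_path w)) =
  arrival (fun i => r i w) (m + l) - arrival (fun i => r i w) m.
Proof.
move=> /good_sample_pos[gE _]; elim: l => [|l IH].
  by rewrite elapsed0 addn0 subrr.
by rewrite elapsedS IH gap_shift gE addnS arrivalS addrAC.
Qed.

Lemma good_sample_service w m : good_sample w ->
  service k (shift m (sample_path w)) = order_stat (fun i => x m i w) k.
Proof.
by move=> /good_sample_pos[_ [dE _]]; rewrite /service delay_shift addn0 dE.
Qed.

Lemma good_sample_stop w j : good_sample w ->
  stop k (cycle_length k (iter j (next_cycle k) (sample_path w)))
    (iter j (next_cycle k) (sample_path w)).
Proof.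
by move=> [_ _ [/(_ j)[m mj] _ _ _ _]]; rewrite (cycle_lengthE kn mj).
Qed.

Lemma good_sample_average w : good_sample w ->
  time_average (age k (fun m => r m w) (fun m i => x m i w) (fun m => s m w) u0 i0)
    tau @[tau --> +oo%R] --> (mean_area k Q / mean_cycle k Q)%:E.
Proof.
move=> gw; have [r0 x0 [gp1 gp2 gp3 gp4 [gp5 gp6 gp7]]] := gw.
have [_ [dE tE]] := good_sample_pos gw.
pose phi := sample_path w; pose th : W -> W := next_cycle k.
pose M := update_index w.
have MSE j : M j.+1 = (M j + cycle_length k (iter j th phi))%N.
  by rewrite /M /update_index big_nat_recr.
have stopM j : stop k (cycle_length k (iter j th phi)) (shift (M j) phi).
  by rewrite -iter_next_cycle; exact: good_sample_stop.
have YE j : cycle_time k (iter j th phi) =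
    arrival (fun i => r i w) (M j.+1) - arrival (fun i => r i w) (M j).
  rewrite /cycle_time {2}iter_next_cycle (good_sample_elapsed _ _ gw).
  by rewrite -MSE.
have hitE j : hit k i0 (iter j th phi) = among_earliest k (fun i => x (M j) i w) (s (M j) w) i0.
  by rewrite iter_next_cycle /hit delay_shift tie_shift addn0 dE tE.
have DE j : delay (iter j th phi) 0 i0 = x (M j) i0 w.
  by rewrite iter_next_cycle delay_shift addn0 dE.
apply: (@time_average_cvg R n k _ _ _ u0 i0 kn u0_le0 r0 x0 M _ _ _ _
  (fun j => receipt k i0 (iter j th phi))
  (fun i j => receipt_upto k i0 i (iter j th phi)) _ _ _ _ _ _
  (mean_cycle k Q) (mean_receipt k Q) (mean_area k Q)).
- by rewrite /M /update_index big_geq.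
- move=> j; rewrite MSE -{1}[M j]addn0 ltn_add2l.
  exact: (stop_gt0 kn (stopM j)).
- move=> j; have /andP[_] := stopM j.
  rewrite (good_sample_service _ gw) (good_sample_elapsed _ _ gw) -MSE /completion.
  by rewrite ltrBrDl.
- move=> j l /andP[Ml]; rewrite MSE => lM.
  have /andP[+ _] := stopM j; rewrite (good_sample_service _ gw) /completion.
  (* Relative to [M j], update l has an index at most [cycle_length - 1], where the elapsed time is
     still at most the service time. *)
  have le_l : elapsed (l - M j) (shift (M j) phi) <=
      elapsed (cycle_length k (iter j th phi)).-1 (shift (M j) phi).
    by apply: elapsed_le; lia.
  move/(le_trans le_l); rewrite (good_sample_elapsed _ _ gw) subnKC ?(ltnW Ml)//.
  by rewrite lerBlDl.
- by move=> j; rewrite gp2 hitE DE YE.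
- by [].
- by move=> i j /=; rewrite hitE DE YE.
- by move=> i j; exact: receipt_upto_ge0.
- by move=> i j; exact: gp3.
- by move=> j; exact: gp4.
- exact: (mean_cycle_gt0 kn sample_cylinder sample_gap2 sample_delay2).
- by under eq_fun do under eq_bigr do rewrite -YE.
- exact: gp6.
- by under eq_fun do under eq_bigr do rewrite -YE.
Qed.

Let Xord (i : nat) (w : T) : R := order_stat (fun j => x 0%N j w) i.
Let Z (w : T) : R := idle_time k (fun m => r m w) (fun m j => x m j w) 0.

Lemma measurable_Xord i : (0 < i <= n)%N -> measurable_fun setT (Xord i).
Proof. by move=> iin; apply: measurable_order_stat => // j; exact: measurable_funP. Qed.

Lemma measurable_arrival m : measurable_fun setT (fun w => arrival (fun i => r i w) m).
Proof. by apply: measurable_sum => j; exact: measurable_funP. Qed.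

Lemma measurable_completion :
  measurable_fun setT (fun w => completion k (fun m => r m w) (fun m j => x m j w) 0).
Proof.
by apply: measurable_funD; [exact: measurable_arrival|exact: measurable_Xord].
Qed.

Lemma measurable_next_arrival :
  measurable_fun setT (fun w => next_arrival k (fun m => r m w) (fun m j => x m j w) 0).
Proof.
pose c w := completion k (fun m => r m w) (fun m j => x m j w) 0.
pose g l w := arrival (fun i => r i w) l.
pose E (w : T) := [set t | exists l : nat, [/\ (0 < l)%N, c w < g l w & t = g l w]].
have mcg l : measurable [set w | c w < g l w].
  by apply: measurable_set_ltr; [exact: measurable_completion|exact: measurable_arrival].
apply: (@measurability _ _ _ _ setT _ (@RGenInftyO.G R)).
  exact: RGenInftyO.measurableE.
move=> _ [_ [a ->] <-]; rewrite setTI.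
(* As the infimum of the empty set is 0, the second part collects the points where no arrival
   follows the completion and [0 < a]. *)
rewrite [X in measurable X](_ : _ =
    \bigcup_l ([set w | (0 < l)%N] `&` [set w | c w < g l w] `&` [set w | g l w < a])
    `|` ([set w | 0 < a] `&` \bigcap_l ~` ([set w | (0 < l)%N] `&` [set w | c w < g l w]))).
  have mb (b : bool) : measurable [set w : T | b].
    by case: b; [rewrite [X in measurable X](_ : _ = setT)|
                 rewrite [X in measurable X](_ : _ = set0)]; rewrite //;
       apply/seteqP; split.
  apply: measurableU.
    apply: bigcupT_measurable => l; apply: measurableI; first exact: measurableI.
    by apply: measurable_set_ltr => //; exact: measurable_arrival.
  apply: measurableI => //; apply: bigcapT_measurable => l; apply: measurableC.
  exact: measurableI.
have lbE w : lbound (E w) (c w) by move=> _ [l [_ cl ->]]; exact: ltW.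
have nE w : next_arrival k (fun m => r m w) (fun m j => x m j w) 0 = inf (E w) by [].
apply/seteqP; split => w /=; rewrite in_itv/= nE.
  have [[t Et]|E0] := pselect (E w !=set0).
    move=> infa; left.
    have [_ [l [l0 cl ->]] la] : exists2 y, E w y & y < a.
      by apply: inf_lt => //; exists t.
    by exists l.
  have -> : inf (E w) = 0.
    rewrite (_ : E w = set0) ?inf0//; apply/seteqP; split => // t Et.
    by apply: E0; exists t.
  move=> a0; right; split => // l _ [/= l0 cl]; apply: E0.
  by exists (g l w), l.
move=> [[l _ [[/= l0 cl] la]]|[a0 h]].
  apply: le_lt_trans la; apply: ge_inf; first by exists (c w).
  by exists l.
rewrite (_ : E w = set0) ?inf0//; apply/seteqP; split => // t [l [l0 cl _]].
by apply: (h l Logic.I).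
Qed.

Lemma measurable_Z : measurable_fun setT Z.
Proof.
by apply: measurable_funB; [exact: measurable_next_arrival|exact: measurable_completion].
Qed.

(** Both sides single out update [cycle_length]: the updates before it arrive no later than the
    completion, and arrival times increase. *)
Lemma good_sample_cycle w : good_sample w ->
  Xord k w + Z w = cycle_time k (sample_path w).
Proof.
move=> gw; have st := good_sample_stop 0 gw; rewrite /= in st.
have /andP[st1 st2] := st; rewrite /cycle_time.
move: st1 st2; set m := cycle_length k (sample_path w) => st1 st2.
have m0 : (0 < m)%N by exact: (stop_gt0 kn st).
have [r0 _ _] := gw.
have aE l : arrival (fun i => r i w) l =
    elapsed l (sample_path w) + arrival (fun i => r i w) 0.
  have := good_sample_elapsed 0 l gw; rewrite shift0 add0n => ->.
  by rewrite subrK.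
have sE : order_stat (fun i => x 0%N i w) k = service k (sample_path w).
  by have := good_sample_service 0 gw; rewrite shift0.
have nE : next_arrival k (fun m => r m w) (fun m j => x m j w) 0 =
    arrival (fun i => r i w) m.
  rewrite /next_arrival; set E := [set _ | _].
  have Em : E (arrival (fun i => r i w) m).
    by exists m; split => //; rewrite /completion sE (aE m) addrC ltrD2r.
  have lbE : lbound E (arrival (fun i => r i w) m).
    move=> _ [l [l0 + ->]]; rewrite /completion sE !(aE l) (aE m) addrC ltrD2r lerD2r.
    move=> sl; apply: elapsed_le; rewrite leqNgt; apply/negP => lm.
    have : elapsed l (sample_path w) <= elapsed m.-1 (sample_path w).
      by apply: elapsed_le; lia.
    by rewrite leNgt (le_lt_trans st1 sl).
  apply/eqP; rewrite eq_le; apply/andP; split.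
    by apply: ge_inf => //; exists (arrival (fun i => r i w) m).
  by apply: lb_le_inf => //; exists (arrival (fun i => r i w) m).
rewrite /Z /idle_time nE /completion /Xord (aE m).
by ring.
Qed.

Lemma measurable_sample (f : W -> R) : measurable_fun setT f ->
  measurable_fun setT (f \o sample_path).
Proof. by move=> mf; exact: (measurableT_comp mf measurable_sample_path). Qed.

Lemma expectation_Xord i : (0 < i <= n)%N ->
  ('E_P[Xord i] = \int[Q]_w (order_stat (delay w 0) i)%:E)%E.
Proof.
move=> iin; rewrite unlock.
have md : measurable_fun setT (fun w : W => order_stat (delay w 0) i).
  by apply: measurable_order_stat => // j; exact: measurable_delay.
rewrite ge0_integral_sample//; last first.
  by move=> w; rewrite ltW//; apply: order_stat_gt0 => // j; exact: delay_gt0.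
apply: ae_eq_integral => //.
- exact/measurable_EFinP/measurable_Xord.
- exact/measurable_EFinP/(measurable_sample md).
- apply: filterS good_sample_ae => w /good_sample_pos[_ [dE _]] _.
  by rewrite dE.
Qed.

Let mY : measurable_fun setT (cycle_time k : W -> R). Proof. exact: measurable_cycle_time. Qed.
Let y := mean_cycle k Q.
Let yE : (\int[Q]_w (cycle_time k w)%:E = y%:E)%E.
Proof. exact: (integral_cycle_time kn sample_cylinder sample_gap2 sample_delay2). Qed.

Lemma expectation_cycle : ('E_P[Xord k] + 'E_P[Z] = y%:E)%E.
Proof.
have ms : measurable_fun setT (service k : W -> R) by exact: measurable_service.
have iY : P.-integrable setT (EFin \o (cycle_time k \o sample_path)).
  apply: ge0_integrable_ltoo; first exact: measurable_sample.
    by move=> w; exact: cycle_time_ge0.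
  by rewrite -ge0_integral_sample// ?yE ?ltry//; exact: cycle_time_ge0.
have iS : P.-integrable setT (EFin \o (service k \o sample_path)).
  apply: ge0_integrable_ltoo; first exact: measurable_sample.
    by move=> w; rewrite ltW//; exact: service_gt0.
  rewrite -ge0_integral_sample//; first exact: (service1 kn sample_delay2).
  by move=> w; rewrite ltW//; exact: service_gt0.
have EX : ('E_P[Xord k] = \int[P]_w (service k (sample_path w))%:E)%E.
  rewrite expectation_Xord// ge0_integral_sample// => w.
  by rewrite ltW//; exact: service_gt0.
(* Almost surely Z is the cycle time minus the service time. Both are integrable, so the service
   time cancels in the sum of the expectations. *)
have EZ : ('E_P[Z] = \int[P]_w (cycle_time k (sample_path w) - service k (sample_path w))%:E)%E.
  rewrite unlock; apply: ae_eq_integral => //.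
  - exact/measurable_EFinP/measurable_Z.
  - by apply/measurable_EFinP; apply: measurable_funB; exact: measurable_sample.
  - apply: filterS good_sample_ae => w gw _; congr EFin.
    rewrite -(good_sample_cycle gw).
    have sE := good_sample_service 0 gw; rewrite shift0 in sE.
    by rewrite sE /Xord addrAC subrr add0r.
rewrite EX EZ; under [X in (_ + X)%E]eq_integral do rewrite EFinB.
rewrite integralB_EFin// addeCA subee ?adde0; last exact: integrable_fin_num.
rewrite -yE ge0_integral_sample//.
by move=> w; exact: cycle_time_ge0.
Qed.

Lemma expectation_sum_Xord :
  (\sum_(1 <= i < k.+1) 'E_P[Xord i] = (n%:R * mean_hit_delay k Q)%:E)%E.
Proof.
rewrite -(integral_sum_order_stat kn sample_delay2).
apply: eq_big_nat => i /andP[i0' ik]; apply: expectation_Xord.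
by rewrite i0' (leq_trans (ik : (i <= k)%N))//; case/andP: kn.
Qed.

Lemma variance_cycle :
  ('V_P[(fun w => (Xord k w + Z w)%R)] =
   (\int[Q]_w (cycle_time k w ^+ 2) - y ^+ 2)%:E)%E.
Proof.
have mF : measurable_fun setT (fun w => Xord k w + Z w).
  by apply: measurable_funD; [exact: measurable_Xord|exact: measurable_Z].
have EF : ('E_P[(fun w => (Xord k w + Z w)%R)] = y%:E)%E.
  rewrite unlock -yE ge0_integral_sample//; last by move=> w; exact: cycle_time_ge0.
  apply: ae_eq_integral => //.
  - exact/measurable_EFinP.
  - exact/measurable_EFinP/(measurable_sample mY).
  - by apply: filterS good_sample_ae => w gw _; rewrite (good_sample_cycle gw).
have m2 : measurable_fun setT (fun w : W => (cycle_time k w - y) ^+ 2).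
  by apply: measurable_funX; exact: measurable_funB.
have -> : ('V_P[(fun w => (Xord k w + Z w)%R)] =
    \int[Q]_w ((cycle_time k w - y) ^+ 2)%:E)%E.
  rewrite /variance unlock EF /= unlock ge0_integral_sample//; last first.
    by move=> w; rewrite sqr_ge0.
  apply: ae_eq_integral => //.
  - by apply/measurable_EFinP; apply: measurable_funM; exact: measurable_funB.
  - exact/measurable_EFinP/(measurable_sample m2).
  - by apply: filterS good_sample_ae => w gw _ /=; rewrite -(good_sample_cycle gw).
have y0 : 0 <= y by exact: (mean_cycle_ge0 kn sample_cylinder sample_gap2 sample_delay2).
have Y0 (w : W) : 0 <= cycle_time k w by exact: cycle_time_ge0.
have e2 : (\int[Q]_w (cycle_time k w ^+ 2)%:E = (\int[Q]_w (cycle_time k w ^+ 2))%:E)%E.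
  rewrite fineK// ge0_fin_numE.
    exact: (cycle_time2 kn sample_cylinder sample_gap2 sample_delay2).
  by apply: integral_ge0 => w _; rewrite lee_fin sqr_ge0.
have Y2 : measurable_fun setT (fun w : W => cycle_time k w ^+ 2) by exact: measurable_funX.
have mc : measurable_fun setT (fun w : W => 2 * y * cycle_time k w) by exact: measurable_funM.
(* The square is expanded with the cross term moved to the other side, so that all integrands are
   nonnegative and [ge0_integralD] applies. *)
have H : (\int[Q]_w ((cycle_time k w - y) ^+ 2)%:E + (2 * y * y)%:E =
    (\int[Q]_w (cycle_time k w ^+ 2))%:E + (y ^+ 2)%:E)%E.
  have -> : ((2 * y * y)%:E = \int[Q]_w (2 * y * cycle_time k w)%:E)%E.
    under eq_integral do rewrite EFinM.
    rewrite ge0_integralZl_EFin ?mulr_ge0//.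
    - by rewrite yE.
    - by move=> w _; rewrite lee_fin.
    - exact/measurable_EFinP.
  have -> : ((y ^+ 2)%:E = \int[Q]_w (y ^+ 2)%:E)%E.
    by rewrite integral_cst// [X in (_ * X)%E]probability_setT mule1.
  rewrite -e2 -!ge0_integralD//.
  - by apply: eq_integral => w _; rewrite -!EFinD; congr EFin; ring.
  - by move=> w _; rewrite lee_fin sqr_ge0.
  - exact/measurable_EFinP.
  - by move=> w _; rewrite lee_fin sqr_ge0.
  - by move=> w _; rewrite lee_fin sqr_ge0.
  - exact/measurable_EFinP.
  - by move=> w _; rewrite lee_fin !mulr_ge0.
  - exact/measurable_EFinP.
have -> : (\int[Q]_w ((cycle_time k w - y) ^+ 2)%:E)%E =
   ((\int[Q]_w (cycle_time k w ^+ 2))%:E + (y ^+ 2)%:E - (2 * y * y)%:E)%E.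
  by rewrite -H addeK.
by rewrite -EFinN -!EFinD; congr EFin; ring.
Qed.

Lemma average_age_main :
  average_age_is P
    (fun w => age k (fun m => r m w) (fun m j => x m j w) (fun m => s m w) u0 i0)
    ((1 / k%:R)%R%:E * \sum_(1 <= i < k.+1) 'E_P[Xord i]
     + ((2 * n%:R - k%:R) / (2 * k%:R))%R%:E * ('E_P[Xord k] + 'E_P[Z])
     + 'V_P[(fun w => (Xord k w + Z w)%R)]
       / (2%:E * ('E_P[Xord k] + 'E_P[Z])))%E.
Proof.
rewrite /average_age_is expectation_cycle expectation_sum_Xord variance_cycle.
have y0 : 0 < y by exact: (mean_cycle_gt0 kn sample_cylinder sample_gap2 sample_delay2).
have k0 : k%:R != 0 :> R by rewrite pnatr_eq0 -lt0n; case/andP: kn.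
have n0 : n%:R != 0 :> R.
  by rewrite pnatr_eq0 -lt0n; case/andP: kn => ? ?; exact: (@leq_trans k).
(* The extended division is a real one because [2 * y] is nonzero. *)
rewrite -[X in (_ / X)%E]EFinM inver mulf_eq0 pnatr_eq0/= gt_eqF//.
rewrite -!EFinM -!EFinD.
set c := (X in X%:E); have -> : c = mean_area k Q / mean_cycle k Q.
  rewrite /c /mean_area /mean_receipt /hit_prob -/y.
  move: (\int[Q]_w _) (mean_hit_delay _ _) => e2 b.
  by field; rewrite k0 n0 (gt_eqF y0).
by apply: filterS good_sample_ae => w; exact: good_sample_average.
Qed.

End main.

Theorem theorem1 (d : measure_display) (T : measurableType d) (R : realType)
    (P : probability T R) (n k : nat) (mu : R)
    (* generic link delay and generic interarrival time *)
    (X Rt : {RV P >-> R})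
    (* interarrival times, link delays and tie-breaking of the updates *)
    (r : nat -> {RV P >-> R}) (x : nat -> 'I_n -> {RV P >-> R})
    (s : nat -> T -> {perm 'I_n})
    (* node under consideration, and the time-stamp it holds at time 0 *)
    (i0 : 'I_n) (u0 : R) :
  (1 <= k <= n)%N ->
  0 < mu ->
  u0 <= 0 ->
  {ae P, forall w, 0 < X w} ->
  {ae P, forall w, 0 < Rt w} ->
  ('E_P[(fun w => (X w ^+ 2)%R)] < +oo)%E ->
  ('E_P[(fun w => (Rt w ^+ 2)%R)] < +oo)%E ->
  ('E_P[Rt])%E = (1 / mu)%:E ->
  (forall m, same_law (r m) Rt) ->
  (forall m i, same_law (x m i) X) ->
  (forall m, uniform_perm P (s m)) ->
  mutually_independent P (source_events r x s) ->
  let Xord (i : nat) (w : T) : R := order_stat (fun j => x 0%N j w) i in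
  let Z (w : T) : R := idle_time k (fun m => r m w) (fun m j => x m j w) 0 in
  average_age_is P
    (fun w => age k (fun m => r m w) (fun m j => x m j w) (fun m => s m w)
                u0 i0)
    ((1 / k%:R)%R%:E * \sum_(1 <= i < k.+1) 'E_P[Xord i]
     + ((2 * n%:R - k%:R) / (2 * k%:R))%R%:E * ('E_P[Xord k] + 'E_P[Z])
     + 'V_P[(fun w => (Xord k w + Z w)%R)]
       / (2%:E * ('E_P[Xord k] + 'E_P[Z])))%E.
Proof.
move=> kn _ u0_le0 X0 Rt0 X2 Rt2 _ r_law x_law s_law indep Xord Z.
rewrite unlock in X2; rewrite unlock in Rt2.
exact: (average_age_main i0 kn u0_le0 X0 Rt0 X2 Rt2 r_law x_law s_law indep).
Qed.
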